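(* Let $R=R(A_1,S)$ be an extended affine root system of type $A_1$ with extended affine Weyl group $\mathcal W$, and let $\hat{\mathcal W}$, $\psi$ and $\Pi$ be as defined in the context. Then the following statements are equivalent: (i) $\hat{\mathcal W}\cong\mathcal W$ (that is, $\mathcal W$ has the presentation by conjugation). (ii) $Z(\hat{\mathcal W})\cong Z(\mathcal W)$. (iii) $Z(\hat{\mathcal W})$ is a free abelian group. (iv) $\psi:\hat{\mathcal W}\longrightarrow\mathcal W$ is an isomorphism. (v) The trivial collection is the only integral collection for $S$. (vi) $\{w_\alpha\mid\alpha\in\Pi\}$ is a minimal set of generators for $\mathcal W$.
   Context: Semilattices. Let $\mathcal V^0$ be a finite dimensional real vector space of dimension $\nu$. A semilattice in $\mathcal V^0$ is a subset $S\subseteq\mathcal V^0$ such that $0\in S$, $S\pm 2S\subseteq S$, $S$ spans $\mathcal V^0$ and $S$ is discrete in $\mathcal V^0$; its rank is $\nu$. The $\mathbb Z$-span $\Lambda$ of $S$ is a lattice in $\mathcal V^0$ having a $\mathbb Z$-basis contained in $S$; fix such a basis $\{\sigma_1,\ldots,\sigma_\nu\}\subseteq S$. For $J\subseteq J_\nu:=\{1,\ldots,\nu\}$ put $\tau_J:=\sum_{j\in J}\sigma_j$ ($\tau_\emptyset=0$). The supporting class $\mathrm{supp}(S)$ is the unique collection of subsets of $J_\nu$ with $\emptyset\in\mathrm{supp}(S)$ and $S=\bigcup_{J\in\mathrm{supp}(S)}(\tau_J+2\Lambda)$. Put $\mathrm{Esupp}(S)=\{J\in\mathrm{supp}(S):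 |J|\ge 3\}$. Integral collections. For $1\le r<s\le\nu$ let $\delta(r,s)=1$ if $\{r,s\}\in\mathrm{supp}(S)$ and $\delta(r,s)=2$ otherwise; for $J\in\mathrm{supp}(S)$ let $\delta(J,r,s)=1$ if $\{r,s\}\subsetneq J$ and $\delta(J,r,s)=0$ otherwise. A collection $\{\epsilon_J\}_{J\in\mathrm{Esupp}(S)}$ with $\epsilon_J\in\{0,1\}$ is an integral collection for $S$ if $\frac{1}{\delta(r,s)}\sum_{J\in\mathrm{Esupp}(S)}\delta(J,r,s)\epsilon_J\in\mathbb Z$ for all $1\le r<s\le\nu$. The trivial collection is the one with all $\epsilon_J=0$ (if $\mathrm{Esupp}(S)=\emptyset$, it is the only collection and it is integral). Root system and Weyl group. Let $\mathcal V=\mathbb R\alpha_1\oplus\mathcal V^0$ with the positive semi-definite symmetric bilinear form having radical $\mathcal V^0$ and $(\alpha_1,\alpha_1)=2$. The extended affine root system $R=R(A_1,S)$ of type $A_1$ and nullity $\nu$ is $R=(S+S)\cup(\pm\alpha_1+S)$, where $S$ is a semilattice in $\mathcal V^0$ (every extended affine root system of type $A_1$ has this form), and $R^\times=\pm\alpha_1+S$ is its set of non-isotropic elements. Let $\tilde{\mathcal V}=\mathcal V\oplus(\mathcal V^0)^*$ with the non-degenerate symmetric form extending that of $\mathcal V$ such that $(\alpha_1,(\mathcal V^0)^* )=((\mathcal V^0)^*,(\mathcal V^0)^* )=0$ and $(\sigma_i,\lambda_j)=\delta_{i,j}$ for a basis $\{\lambda_1,\ldots,\lambda_\nu\}$ of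 $(\mathcal V^0)^*$. The extended affine Weyl group $\mathcal W$ of $R$ is the subgroup of the orthogonal group of $\tilde{\mathcal V}$ generated by the reflections $w_\alpha(u)=u-(u,\alpha)\alpha$, $\alpha\in R^\times$. Presented group. $\hat{\mathcal W}$ is the group with generators $\hat w_\alpha$, $\alpha\in R^\times$, and relations $\hat w_\alpha^2=1$ ($\alpha\in R^\times$) and $\hat w_\alpha\hat w_\beta\hat w_\alpha=\hat w_{w_\alpha(\beta)}$ ($\alpha,\beta\in R^\times$). $\mathcal W$ is said to have the presentation by conjugation if $\mathcal W\cong\hat{\mathcal W}$. The assignment $\hat w_\alpha\mapsto w_\alpha$ induces an epimorphism $\psi:\hat{\mathcal W}\to\mathcal W$. Set $\Pi=\{\alpha_1+\tau_J\mid J\in\mathrm{supp}(S)\}$. $Z(G)$ denotes the center of a group $G$. A minimal set of generators is a generating set no proper subset of which generates.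
   Formalization: The nullity ν is assumed to be at least 1: for ν = 0 one has S = {0} and both groups are Z/2, so (i) holds while (iii) fails because Z/2 is not free abelian. *)

(* Defs.v *)
From HB Require Import structures.
From mathcomp Require Import all_boot all_order all_algebra.
From mathcomp Require Import all_classical all_reals all_analysis.
From mathcomp Require Import ring.

Set Implicit Arguments.
Unset Strict Implicit.
Unset Printing Implicit Defensive.

Import Order.TTheory GRing.Theory Num.Theory.
Import numFieldNormedType.Exports.

Local Open Scope classical_set_scope.
Local Open Scope ring_scope.

Section Groups.
Variable G : groupType.
Implicit Types (A B X : set G) (x y : G).

Definition subgroup A : Prop :=
  A 1%g /\ forall x y, A x -> A y -> A (x * y^-1)%g.

Definition generated X : set G := smallest subgroup X.

Definition group_center A : set G :=
  [set z | A z /\ forall x, A x -> (z * x)%g = (x * z)%g].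

Definition zexpg x (n : int) : G :=
  match n with Posz m => (x ^+ m)%g | Negz m => (x ^- m.+1)%g end.

Definition group_independent B : Prop :=
  forall (s : seq G) (c : G -> int), uniq s -> {subset s <= B} ->
    (\prod_(b <- s) zexpg b (c b))%g = 1%g -> forall b, b \in s -> c b = 0.

(* A basis may be empty or infinite; the trivial group is free of rank 0. *)
Definition free_abelian A : Prop :=
  [/\ subgroup A,
      forall x y, A x -> A y -> (x * y)%g = (y * x)%g
    & exists2 B : set G, generated B = A & group_independent B].

Definition minimal_generators A X : Prop :=
  generated X = A /\ forall Y, Y `<` X -> generated Y <> A.

Lemma involutions_conjK x y : (x * x = 1)%g -> (y * y = 1)%g ->
  (x * (y * (x * (x * (y * x)))) = 1)%g.
Proof.
by move=> xx yy; rewrite (mulgA x x) xx mul1g (mulgA y y) yy mul1g xx.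
Qed.

End Groups.

Definition is_group_iso (G H : groupType) (A : set G) (B : set H)
    (f : G -> H) : Prop :=
  {in A &, {morph f : x y / (x * y)%g}} /\ set_bij A B f.

Definition group_isog (G H : groupType) (A : set G) (B : set H) : Prop :=
  exists f : G -> H, is_group_iso A B f.

Section Presentation.
Variable X : choiceType.

(* The letter (x, false) stands for x, and (x, true) for its inverse. *)
Definition word := seq (X * bool).
HB.instance Definition _ := Choice.on word.

Variable rels : set word.

Inductive word_equiv : word -> word -> Prop :=
| word_equiv_refl u : word_equiv u u
| word_equiv_sym u v : word_equiv u v -> word_equiv v u
| word_equiv_trans u v w : word_equiv u v -> word_equiv v w -> word_equiv u w
| word_equiv_cancel u v x b :
    word_equiv (u ++ (x, b) :: (x, ~~ b) :: v) (u ++ v)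
| word_equiv_relator u v r : rels r -> word_equiv (u ++ r ++ v) (u ++ v).

Definition word_equivb (u v : word) : bool := `[< word_equiv u v >].

Lemma word_equivb_refl : reflexive word_equivb.
Proof. by move=> u; apply/asboolP; exact: word_equiv_refl. Qed.

Lemma word_equivb_sym : symmetric word_equivb.
Proof. by move=> u v; apply/asboolP/asboolP; exact: word_equiv_sym. Qed.

Lemma word_equivb_trans : transitive word_equivb.
Proof.
move=> v u w /asboolP uv /asboolP vw; apply/asboolP.
exact: word_equiv_trans uv vw.
Qed.

Canonical word_equiv_rel :=
  EquivRel word_equivb word_equivb_refl word_equivb_sym word_equivb_trans.

Definition presented := {eq_quot word_equiv_rel}%qT.
HB.instance Definition _ := Choice.on presented.

Definition cls (u : word) : presented := (\pi_({eq_quot word_equiv_rel}) u)%qT.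

Lemma cls_eq u v : word_equiv u v -> cls u = cls v.
Proof. by move=> uv; apply/eqmodP/asboolP. Qed.

Lemma repr_cls u : word_equiv (repr (cls u)) u.
Proof. by apply/asboolP; apply/(@eqmodP _ word_equiv_rel); rewrite reprK. Qed.

Definition word_inv (u : word) : word := rev [seq (l.1, ~~ l.2) | l <- u].

Lemma word_equiv_catl w u v : word_equiv u v -> word_equiv (w ++ u) (w ++ v).
Proof.
elim=> {u v}.
- by move=> u; exact: word_equiv_refl.
- by move=> u v _; exact: word_equiv_sym.
- by move=> u v z _ uv _; exact: word_equiv_trans.
- by move=> u v x b; rewrite !catA; exact: word_equiv_cancel.
- move=> u v r rr; rewrite (catA w u (r ++ v)) (catA w u v).
  exact: word_equiv_relator.
Qed.

Lemma word_equiv_catr w u v : word_equiv u v -> word_equiv (u ++ w) (v ++ w).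
Proof.
elim=> {u v}.
- by move=> u; exact: word_equiv_refl.
- by move=> u v _; exact: word_equiv_sym.
- by move=> u v z _ uv _; exact: word_equiv_trans.
- by move=> u v x b; rewrite -!catA /=; exact: word_equiv_cancel.
- by move=> u v r rr; rewrite -!catA; exact: word_equiv_relator.
Qed.

Lemma word_equiv_cat u v w z :
  word_equiv u v -> word_equiv w z -> word_equiv (u ++ w) (v ++ z).
Proof.
move=> uv wz; apply: word_equiv_trans (word_equiv_catr w uv) _.
exact: word_equiv_catl.
Qed.

Lemma word_mulVw u : word_equiv (word_inv u ++ u) [::].
Proof.
elim: u => [|[x b] u IHu]; first exact: word_equiv_refl.
rewrite /word_inv /= rev_cons cat_rcons.
apply: word_equiv_trans IHu.
by rewrite -{2}[b]negbK; exact: word_equiv_cancel.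
Qed.

Lemma word_invK : involutive word_inv.
Proof.
move=> u; rewrite /word_inv map_rev revK -map_comp -[RHS]map_id.
by apply: eq_map => -[x b] /=; rewrite negbK.
Qed.

Lemma word_mulwV u : word_equiv (u ++ word_inv u) [::].
Proof. by rewrite -{1}(word_invK u); exact: word_mulVw. Qed.

Definition presented_one : presented := cls [::].
Definition presented_mul (x y : presented) : presented :=
  cls (repr x ++ repr y).
Definition presented_inv (x : presented) : presented := cls (word_inv (repr x)).

Lemma presented_mulA : associative presented_mul.
Proof.
move=> x y z; apply: cls_eq.
apply: (@word_equiv_trans _ (repr x ++ (repr y ++ repr z))).
  exact/word_equiv_catl/repr_cls.
by rewrite catA; apply/word_equiv_sym/word_equiv_catr/repr_cls.
Qed.

Lemma presented_mul1 : left_id presented_one presented_mul.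
Proof.
move=> x; rewrite -[RHS]reprK; apply: cls_eq.
exact: (word_equiv_catr _ (repr_cls [::])).
Qed.

Lemma presented_mulr1 : right_id presented_one presented_mul.
Proof.
move=> x; rewrite -[RHS]reprK; apply: cls_eq.
by rewrite -[X in word_equiv _ X]cats0; exact/word_equiv_catl/repr_cls.
Qed.

Lemma presented_mulV : left_inverse presented_one presented_inv presented_mul.
Proof.
move=> x; apply: cls_eq.
exact: word_equiv_trans (word_equiv_catr _ (repr_cls _)) (word_mulVw _).
Qed.

Lemma presented_mulrV : right_inverse presented_one presented_inv presented_mul.
Proof.
move=> x; apply: cls_eq.
exact: word_equiv_trans (word_equiv_catl _ (repr_cls _)) (word_mulwV _).
Qed.

HB.instance Definition _ := isGroup.Build presented
  presented_mulA presented_mul1 presented_mulr1 presented_mulV presented_mulrV.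

Definition presented_gen (x : X) : presented := cls [:: (x, false)].

Section Lift.
Variables (G : groupType) (f : X -> G).

Definition eval_word (u : word) : G :=
  (\prod_(l <- u) (if l.2 then (f l.1)^-1 else f l.1))%g.

(* The homomorphism induced by f as soon as f kills all the relators. *)
Definition presented_lift (x : presented) : G := eval_word (repr x).

Hypothesis f_rels : forall r, rels r -> eval_word r = 1%g.

Lemma eval_word_equiv u v : word_equiv u v -> eval_word u = eval_word v.
Proof.
rewrite /eval_word; elim=> {u v} //.
- by move=> u v w _ -> _ ->.
- move=> u v x b; rewrite !big_cat !big_cons /= mulgA.
  by case: b => /=; rewrite ?mulgV ?mulVg -!mulgA ?mulKg ?mulVKg.
- by move=> u v r /f_rels; rewrite /eval_word !big_cat => ->; rewrite /= mul1g.
Qed.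

Lemma presented_liftM : {morph presented_lift : x y / (x * y)%g}.
Proof.
move=> x y; rewrite /presented_lift (eval_word_equiv (repr_cls _)).
by rewrite /eval_word big_cat.
Qed.

Lemma presented_lift_gen x : presented_lift (presented_gen x) = f x.
Proof.
rewrite /presented_lift (eval_word_equiv (repr_cls _)).
by rewrite /eval_word big_seq1.
Qed.

End Lift.
End Presentation.

Section Orthogonal.
Variables (K : fieldType) (V : vectType K) (form : V -> V -> K).

Definition orthogonal_endo : set 'End(V) :=
  [set g | lker g = 0%VS /\ forall u v, form (g u) (g v) = form u v].

Definition orthogonal_group := set_type orthogonal_endo.
HB.instance Definition _ := Choice.on orthogonal_group.

Lemma orthogonalP (g : orthogonal_group) : orthogonal_endo (val g).
Proof. exact/set_mem/valP. Qed.

Definition Orthogonal (g : 'End(V)) (og : orthogonal_endo g) :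
    orthogonal_group :=
  exist _ g (mem_set og).

Lemma orthogonal1 : orthogonal_endo \1%VF.
Proof.
split=> [|u v]; last by rewrite !id_lfunE.
by apply/eqP/lker0P => u v; rewrite !id_lfunE.
Qed.

Lemma orthogonalM g h :
  orthogonal_endo g -> orthogonal_endo h -> orthogonal_endo (g \o h)%VF.
Proof.
move=> [/eqP/lker0P gi go] [/eqP/lker0P hi ho]; split=> [|u v].
  by apply/eqP/lker0P => u v; rewrite !comp_lfunE => /gi/hi.
by rewrite !comp_lfunE go ho.
Qed.

Lemma orthogonalV g : orthogonal_endo g -> orthogonal_endo (g^-1)%VF.
Proof.
move=> [/eqP gi go]; have gK := lker0_lfunVK gi.
split=> [|u v]; last by rewrite -go !gK.
by apply/eqP/lker0P => u v uv; rewrite -(gK u) uv gK.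
Qed.

Definition orthogonal_one : orthogonal_group := Orthogonal orthogonal1.
Definition orthogonal_mul (g h : orthogonal_group) : orthogonal_group :=
  Orthogonal (orthogonalM (orthogonalP g) (orthogonalP h)).
Definition orthogonal_inv (g : orthogonal_group) : orthogonal_group :=
  Orthogonal (orthogonalV (orthogonalP g)).

Lemma orthogonal_mulA : associative orthogonal_mul.
Proof. by move=> f g h; apply: val_inj; rewrite /= comp_lfunA. Qed.

Lemma orthogonal_mul1 : left_id orthogonal_one orthogonal_mul.
Proof. by move=> g; apply: val_inj; rewrite /= comp_lfun1l. Qed.

Lemma orthogonal_mulr1 : right_id orthogonal_one orthogonal_mul.
Proof. by move=> g; apply: val_inj; rewrite /= comp_lfun1r. Qed.

Lemma orthogonal_mulV :
  left_inverse orthogonal_one orthogonal_inv orthogonal_mul.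
Proof.
move=> g; apply: val_inj => /=; have [/eqP gi _] := orthogonalP g.
by rewrite lker0_compVf.
Qed.

Lemma orthogonal_mulrV :
  right_inverse orthogonal_one orthogonal_inv orthogonal_mul.
Proof.
move=> g; apply: val_inj => /=; have [/eqP gi _] := orthogonalP g.
by rewrite lker0_compfV.
Qed.

HB.instance Definition _ := isGroup.Build orthogonal_group
  orthogonal_mulA orthogonal_mul1 orthogonal_mulr1
  orthogonal_mulV orthogonal_mulrV.

End Orthogonal.

Section Semilattice.
Variables (R : realType) (V0 : vectType R).
Implicit Type S : set V0.

Definition coordinates (v : V0) : 'rV[R]_(\dim {:V0}) :=
  \row_i coord (vbasis {:V0}) i v.

(* Discreteness in the topology of R^nu, transported by the coordinates in some
   basis; by finite dimensionality the choice of the basis is immaterial. *)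
Definition discrete_in_vect S : Prop :=
  coordinates @` S `<=` isolated (coordinates @` S).

Record semilattice S : Prop := Semilattice {
  semilattice0 : S 0;
  semilatticeD2 : forall s t, S s -> S t -> S (s + t *+ 2);
  semilatticeB2 : forall s t, S s -> S t -> S (s - t *+ 2);
  semilattice_span :
    forall U : {vspace V0}, (forall s, S s -> s \in U) -> U = fullv;
  semilattice_discrete : discrete_in_vect S }.

Definition zspan S : set V0 :=
  smallest (fun A : set V0 => A 0 /\ forall x y, A x -> A y -> A (x - y)) S.

Variable nu : nat.
Implicit Types (sigma : 'I_nu -> V0) (supp : {set {set 'I_nu}}).

Definition zbasis (L : set V0) sigma : Prop :=
  zspan (range sigma) = L /\
  forall c : 'I_nu -> int, \sum_i sigma i *~ c i = 0 -> forall i, c i = 0.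

Definition tau sigma (J : {set 'I_nu}) : V0 := \sum_(j in J) sigma j.

Definition supporting_class S sigma supp : Prop :=
  finset.set0 \in supp /\
  S = \bigcup_(J in [set` supp]) [set tau sigma J + l *+ 2 | l in zspan S].

End Semilattice.

Section Integral.
Variables (nu : nat) (supp : {set {set 'I_nu}}).

Definition Esupp : {set {set 'I_nu}} := [set J in supp | 3 <= #|J|]%N%SET.

Definition delta (r s : 'I_nu) : nat :=
  if [set r; s]%SET \in supp then 1 else 2.

Definition deltaJ (J : {set 'I_nu}) (r s : 'I_nu) : nat :=
  if [set r; s]%SET \proper J then 1 else 0.

Definition collection := {J : {set 'I_nu} | J \in Esupp} -> 'I_2.

Definition integral_collection (eps : collection) : Prop :=
  forall r s : 'I_nu, (r < s)%N ->
    ((delta r s)%:R^-1 * \sum_J (deltaJ (val J) r s)%:R * (eps J)%:R : rat)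
      \is a Num.int.

Definition trivial_collection : collection := fun _ => ord0.

End Integral.

Section RootSystem.
Variables (R : realType) (V0 : vectType R).

(* (a, v) is a alpha_1 + v, with alpha_1 = (1, 0), and (a, v, f) is
   (a alpha_1 + v) + f, with f in the dual of V0. *)
Definition rootspace : vectType R := (R^o * V0)%type.
Definition hyperspace : vectType R := (rootspace * 'Hom(V0, R^o))%type.

Definition alpha1 : rootspace := (1, 0).
Definition isotropic (v : V0) : rootspace := (0, v).
Definition hyper (a : rootspace) : hyperspace := (a, 0).

Definition root_form (a b : rootspace) : R := a.1 * b.1 * 2.

(* The dual basis of any basis sigma of V0 satisfies
   (sigma_i, lambda_j) = delta_ij for this canonical pairing. *)
Definition hyper_form (u v : hyperspace) : R :=
  root_form u.1 v.1 + v.2 u.1.2 + u.2 v.1.2.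

Definition root_reflection (a b : rootspace) : rootspace :=
  b - root_form b a *: a.

Definition hyper_reflection_fun (a u : hyperspace) : hyperspace :=
  u - hyper_form u a *: a.

Definition hyper_reflection (a : hyperspace) : 'End(hyperspace) :=
  linfun (hyper_reflection_fun a).

Variable S : set V0.

Definition nonisotropic_roots : set rootspace :=
  [set a | exists2 s, S s &
     a = alpha1 + isotropic s \/ a = - alpha1 + isotropic s].

Definition ears : set rootspace :=
  [set isotropic (s + t) | s in S & t in S] `|` nonisotropic_roots.

Lemma nonisotropic_rootsE :
  nonisotropic_roots = [set a | ears a /\ root_form a a <> 0].
Proof.
apply/seteqP; split=> [a ra|a [[[s _ [t _ <-]]|//]]]; last first.
  by rewrite /root_form /= !mul0r.
split; first by right.
case: ra => s _ [->|->]; rewrite /root_form /= addr0 ?mulrNN mul1r mul1r;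
  by apply/eqP; rewrite pnatr_eq0.
Qed.

Lemma nonisotropic_root_form a : nonisotropic_roots a -> root_form a a = 2.
Proof.
by case=> s _ [->|->]; rewrite /root_form /= addr0 ?mulrNN mul1r mul1r.
Qed.

Lemma hyper_formC u v : hyper_form u v = hyper_form v u.
Proof. by rewrite /hyper_form /root_form; ring. Qed.

Lemma hyper_form_linear w k u v :
  hyper_form (k *: u + v) w = k * hyper_form u w + hyper_form v w.
Proof.
pose x : R := u.1.1; pose y : R := v.1.1; pose z : R := w.1.1.
pose p : R := w.2 u.1.2; pose q : R := w.2 v.1.2.
pose p' : R := u.2 w.1.2; pose q' : R := v.2 w.1.2.
transitivity ((k * x + y) * z * 2 + (k * p + q) + (k * p' + q')).
  by rewrite /hyper_form /root_form /= linearP add_lfunE scale_lfunE.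
transitivity (k * (x * z * 2 + p + p') + (y * z * 2 + q + q')); last by [].
by ring.
Qed.

Lemma hyper_reflection_fun_linear a : linear (hyper_reflection_fun a).
Proof.
move=> k u v; rewrite /hyper_reflection_fun hyper_form_linear.
by rewrite scalerDl opprD scalerBr addrACA scalerA.
Qed.

HB.instance Definition _ a := GRing.isLinear.Build R hyperspace hyperspace _
  (hyper_reflection_fun a) (hyper_reflection_fun_linear a).

Lemma hyper_reflectionE a u :
  hyper_reflection a u = u - hyper_form u a *: a.
Proof. by rewrite lfunE. Qed.

Lemma hyper_reflection_orthogonal a :
  hyper_form a a = 2 -> orthogonal_endo hyper_form (hyper_reflection a).
Proof.
move=> aa2.
have faB u k v :
    hyper_form (u - k *: a) v = hyper_form u v - k * hyper_form a v.
  by rewrite addrC -scaleNr hyper_form_linear mulNr addrC.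
have ra u : hyper_form (hyper_reflection a u) a = - hyper_form u a.
  by rewrite hyper_reflectionE faB aa2; ring.
split=> [|u v].
  apply/eqP/lker0P => u v uv; have := uv.
  have : hyper_form u a = hyper_form v a by apply: oppr_inj; rewrite -!ra uv.
  by rewrite !hyper_reflectionE => -> /subIr.
rewrite [in LHS]hyper_reflectionE faB hyper_formC (hyper_formC a) ra.
rewrite hyper_reflectionE faB (hyper_formC v u) (hyper_formC a u); ring.
Qed.

Lemma hyper_form_hyper a b : hyper_form (hyper a) (hyper b) = root_form a b.
Proof. by rewrite /hyper_form /= !zero_lfunE !addr0. Qed.

Lemma reflection_orthogonal (a : nonisotropic_roots) :
  orthogonal_endo hyper_form (hyper_reflection (hyper (val a))).
Proof.
apply: hyper_reflection_orthogonal.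
by rewrite hyper_form_hyper nonisotropic_root_form //; exact/set_mem/valP.
Qed.

Definition reflection (a : nonisotropic_roots) : orthogonal_group hyper_form :=
  Orthogonal (reflection_orthogonal a).

Definition weyl_group : set (orthogonal_group hyper_form) :=
  generated (range reflection).

Definition involution_relator (a : nonisotropic_roots) :
  word nonisotropic_roots := [:: (a, false); (a, false)].

Definition conjugation_relator (a b c : nonisotropic_roots) :
    word nonisotropic_roots :=
  [:: (a, false); (b, false); (a, false); (c, true)].

Definition conjugation_relators : set (word nonisotropic_roots) :=
  range involution_relator `|`
  [set r | exists a b c : nonisotropic_roots,
     val c = root_reflection (val a) (val b) /\ r = conjugation_relator a b c].

Definition weyl_hat : groupType := presented conjugation_relators.

Definition psi : weyl_hat -> orthogonal_group hyper_form :=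
  presented_lift reflection.

Lemma reflection_relators r :
  conjugation_relators r -> eval_word reflection r = 1%g.
Proof.
have refl2 a : (reflection a * reflection a)%g = 1%g.
  apply/val_inj/lfunP => u /=; rewrite comp_lfunE id_lfunE.
  have faa : hyper_form (hyper (val a)) (hyper (val a)) = 2.
    by rewrite hyper_form_hyper nonisotropic_root_form //; exact/set_mem/valP.
  rewrite !hyper_reflectionE; set h := hyper _ in faa *.
  rewrite [X in _ - X *: _](_ : _ = - hyper_form u h).
    by rewrite scaleNr opprK subrK.
  by rewrite addrC -scaleNr hyper_form_linear faa /GRing.scale /=; ring.
have reflV a : (reflection a)^-1%g = reflection a.
  by apply: (mulgI (reflection a)); rewrite mulgV refl2.
case=> [[a _ <-]|[a [b [c [abc ->]]]]]; rewrite /eval_word !big_cons big_nil /=.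
  by rewrite mulg1 refl2.
rewrite mulg1 reflV.
suff -> : reflection c = (reflection a * (reflection b * reflection a))%g.
  exact: involutions_conjK.
apply/val_inj/lfunP => u /=.
have hc : hyper (val c) = hyper_reflection (hyper (val a)) (hyper (val b)).
  rewrite hyper_reflectionE hyper_form_hyper abc.
  by rewrite /hyper /root_reflection; congr pair; rewrite /= scaler0 subr0.
have [_ ao] := reflection_orthogonal a.
have ainv v : hyper_reflection (hyper (val a))
                (hyper_reflection (hyper (val a)) v) = v.
  have /(congr1 val)/(congr1 (fun g : 'End(_) => g v)) := refl2 a.
  by rewrite /= comp_lfunE id_lfunE.
rewrite !comp_lfunE hyper_reflectionE hc -{1 2}(ainv u) ao.
by rewrite (hyper_reflectionE (hyper (val b))) [RHS]linearB [in RHS]linearZ.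
Qed.

Lemma psiM : {morph psi : x y / (x * y)%g}.
Proof. exact/presented_liftM/reflection_relators. Qed.

Lemma psi_gen a : psi (presented_gen conjugation_relators a) = reflection a.
Proof. exact/presented_lift_gen/reflection_relators. Qed.

Definition Pi_roots (nu : nat) (sigma : 'I_nu -> V0)
    (supp : {set {set 'I_nu}}) : set rootspace :=
  [set alpha1 + isotropic (tau sigma J) | J in [set` supp]].

Definition Pi_reflections (nu : nat) (sigma : 'I_nu -> V0)
    (supp : {set {set 'I_nu}}) : set (orthogonal_group hyper_form) :=
  [set reflection a | a in [set a | Pi_roots sigma supp (val a)]].

End RootSystem.

(* Main.v *)
Require Import Defs.
From HB Require Import structures.
From mathcomp Require Import all_boot all_order all_algebra.
From mathcomp Require Import all_classical all_reals all_analysis.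
From mathcomp Require Import zify ring lra.

(* Write x_s for the generator of the presented group attached to alpha_1 + s
   and t_s = x_s x_0. Then x_s x_t x_s = x_(2s - t), so t_s acts on the x_u as
   the translation u |-> u + 2s, commutators of the t_s are central, and so are
   the defects z_J = (prod_(j in J) t_(sigma_j)) t_(tau_J)^-1. Conjugation by
   x_0 inverts the t_s and fixes central elements, whence z_J^2 is a product of
   commutators. Consequently the kernel of psi lies in the abelian group
   generated by the z_J with |J| >= 3 and by elements y_rs (z_{r,s} if {r,s} is
   in supp(S), the commutator of t_(sigma_r) and t_(sigma_s) otherwise), where
   2 z_J is a combination of the y_rs.
   In the Weyl group the central elements are determined by their coordinates
   on sigma_r /\ sigma_s, r < s; z_J has coordinate 1 when r, s are in J, and
   y_rs has coordinate delta(r,s). So sum_J eps_J z_J + sum n_rs y_rs is in the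
   kernel iff eps is integral and n is the resulting quotient, and the
   characters x_s |-> [s in tau_J + 2 Lambda] in Z/2 show that such an element
   is trivial only when eps is. Hence (iv) <-> (v). The kernel being killed by
   2 while the center of the Weyl group is free, (ii) -> (iii) -> (iv); the same
   characters give (iv) -> (vi), and a nontrivial integral collection expresses
   some z_J, |J| >= 3, hence the reflection in alpha_1 + tau_J, through the
   other reflections of Pi, which gives (vi) -> (v). *)

Set Implicit Arguments.
Unset Strict Implicit.
Unset Printing Implicit Defensive.

Import Order.TTheory GRing.Theory Num.Theory.

Local Open Scope classical_set_scope.
Local Open Scope ring_scope.

(** * Subgroups, centers and freeness *)

Section GeneratedSubgroups.
Variable G : groupType.
Implicit Types (A X : set G) (x y : G).

Lemma subgroupV A x : subgroup A -> A x -> A (x^-1)%g.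
Proof. by move=> [A1 Ad] Ax; rewrite -[(x^-1)%g]mul1g; exact: Ad. Qed.

Lemma subgroupM A x y : subgroup A -> A x -> A y -> A (x * y)%g.
Proof.
move=> sA Ax Ay; rewrite -[y]invgK; apply: sA.2 => //; exact: subgroupV.
Qed.

Lemma subgroup_prod A (I : eqType) (r : seq I) (F : I -> G) : subgroup A ->
  (forall i, i \in r -> A (F i)) -> A (\prod_(i <- r) F i)%g.
Proof.
move=> sA; elim: r => [|i r IHr] rA; first by rewrite big_nil; exact: sA.1.
rewrite big_cons; apply: subgroupM => //; first by apply: rA; rewrite mem_head.
by apply: IHr => j jr; apply: rA; rewrite inE jr orbT.
Qed.

Lemma generated_subgroup X : subgroup (generated X).
Proof.
split=> [A [sA _]|x y Xx Xy A AX]; first exact: sA.1.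
by apply: AX.1.2; [exact: Xx | exact: Xy].
Qed.

Lemma sub_generated X : X `<=` generated X.
Proof. exact: sub_gen_smallest. Qed.

Lemma generated_min A X : subgroup A -> X `<=` A -> generated X `<=` A.
Proof. exact: smallest_sub. Qed.

Lemma subgroup_commute x : subgroup [set y | commute x y].
Proof.
split=> [|y z /= xy xz]; first exact: commute1.
by apply: commuteM => //; exact: commuteV.
Qed.

(** As the generators are their own inverses, multiplying by generators on the left reaches
    everything; the [g] such that [g] and its inverse both preserve [P] form a subgroup. *)
Lemma generated_involutions_ind X (P : set G) :
  (forall x, X x -> x * x = 1)%g -> P 1%g ->
  (forall x g, X x -> P g -> P (x * g)%g) -> generated X `<=` P.
Proof.
move=> X2 P1 PX g Xg.
suff : generated X `<=` [set g | forall h, P h -> P (g * h)%g /\ P (g^-1 *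
  h)%g].
  by move=> /(_ g Xg 1%g P1)[]; rewrite mulg1.
apply: generated_min => [|x Xx h Ph]; last first.
  by rewrite (mulg1_eq (X2 x Xx)); split; exact: PX.
split=> [h Ph|a b aP bP h Ph]; first by rewrite invg1 mul1g.
rewrite invgF -!mulgA; split.
  by have [_ /aP[]] := bP h Ph.
by have [_ /bP[]] := aP h Ph.
Qed.

End GeneratedSubgroups.

(** * The center of a group in additive notation *)

Section Center.
Variable G : groupType.

Definition center := set_type (group_center [set: G]).
HB.instance Definition _ := Choice.on center.

Definition cval (z : center) : G := val z.

Lemma center_commute (z : center) x : commute (cval z) x.
Proof. by have [_ zC] := set_mem (valP z); exact: zC. Qed.

Definition mkCenter z (zC : forall x, commute z x) : center :=
  exist _ z (mem_set (conj I (fun x _ => zC x))).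

Lemma cval_inj : injective cval. Proof. exact: val_inj. Qed.

Fact center0_subproof (x : G) : commute 1%g x.
Proof. exact/commute_sym/commute1. Qed.

Fact centerN_subproof (z : center) x : commute (cval z)^-1%g x.
Proof. exact/commute_sym/commuteV/commute_sym/center_commute. Qed.

Fact centerD_subproof (z w : center) x : commute (cval z * cval w)%g x.
Proof. by apply/commute_sym/commuteM; exact/commute_sym/center_commute. Qed.

Definition center0 := mkCenter center0_subproof.
Definition centerN z := mkCenter (centerN_subproof z).
Definition centerD z w := mkCenter (centerD_subproof z w).

Fact centerA : associative centerD.
Proof. by move=> x y z; apply: cval_inj; exact: mulgA. Qed.
Fact centerC : commutative centerD.
Proof. by move=> x y; apply: cval_inj; exact: center_commute. Qed.
Fact center0D : left_id center0 centerD.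
Proof. by move=> x; apply: cval_inj; exact: mul1g. Qed.
Fact centerND : left_inverse center0 centerN centerD.
Proof. by move=> x; apply: cval_inj; exact: mulVg. Qed.

HB.instance Definition _ :=
  GRing.isZmodule.Build center centerA centerC center0D centerND.

Lemma cval0 : cval 0 = 1%g. Proof. by []. Qed.
Lemma cvalD z w : cval (z + w) = (cval z * cval w)%g. Proof. by []. Qed.
Lemma cvalN z : cval (- z) = (cval z)^-1%g. Proof. by []. Qed.
Lemma cvalMn z n : cval (z *+ n) = (cval z ^+ n)%g.
Proof. by elim: n => [|n IHn] //; rewrite mulrS expgS cvalD IHn. Qed.
Lemma cvalMz z n : cval (z *~ n) = zexpg (cval z) n.
Proof.
by case: n => n; rewrite -?pmulrn ?cvalMn // NegzE mulrNz -pmulrn cvalN cvalMn.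
Qed.
Lemma cval_sum I (r : seq I) (P : pred I) F :
  cval (\sum_(i <- r | P i) F i) = (\prod_(i <- r | P i) cval (F i))%g.
Proof. exact: (big_morph cval cvalD cval0). Qed.

Lemma center_subP z : group_center [set: G] z -> exists w, z = cval w.
Proof.
by move=> [_ zC]; exists (mkCenter (fun x => zC x Logic.I)).
Qed.

End Center.

(** * Bases of groups with separating integer coordinates *)

Section FreeAbelian.
Variable M : zmodType.

Lemma sub_closedMz (A : set M) x (n : int) :
  A 0 -> (forall x y, A x -> A y -> A (x - y)) -> A x -> A (x *~ n).
Proof.
move=> A0 AB Ax.
have AN y : A y -> A (- y) by move=> Ay; rewrite -[- y]add0r; exact: AB.
have AD y z : A y -> A z -> A (y + z).
  by move=> Ay Az; rewrite -[z]opprK; apply/AB => //; exact: AN.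
have An m : A (x *+ m) by elim: m => [|m IHm] //; rewrite mulrS; exact: AD.
by case: n => n; rewrite -?pmulrn // NegzE mulrNz -pmulrn; exact: AN.
Qed.

(* The coordinates are eliminated one at a time: the minimal positive value of
   the last one on A is attained at a, and A is the direct sum of the line of a
   and of the kernel of that coordinate. *)
Lemma free_of_coordinates n (f : nat -> {additive M -> int}) (A : set M) :
  A 0 -> (forall x y, A x -> A y -> A (x - y)) ->
  (forall x, A x -> (forall i, (i < n)%N -> f i x = 0) -> x = 0) ->
  exists B : set M, [/\ B `<=` A,
    forall D : set M, D 0 -> (forall x y, D x -> D y -> D (x - y)) ->
      B `<=` D -> A `<=` D
  & forall (s : seq M) (c : M -> int), uniq s -> {subset s <= B} ->
      \sum_(b <- s) b *~ c b = 0 -> forall b, b \in s -> c b = 0].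
Proof.
elim: n A => [|n IHn] A A0 AB fA.
  exists set0; split=> // [D D0 _ _ x Ax|[|b s] c _ sB _ b' //].
    by rewrite (fA x).
  by have := sB b (mem_head _ _); rewrite in_set0.
have [[x0 Ax0 fx0]|fn0] := pselect (exists2 x, A x & f n x != 0); last first.
  apply: IHn => // x Ax fx; apply: fA => // i; rewrite ltnS leq_eqVlt.
  case/predU1P => [->|]; last exact: fx.
  by apply/eqP/negPn/negP => fnx; apply: fn0; exists x.
have AN x : A x -> A (- x) by move=> Ax; rewrite -[- x]add0r; exact: AB.
pose P m := (0 < m)%N && `[< exists2 x, A x & f n x = m%:Z >].
have exP : exists m, P m.
  exists `|f n x0|%N; rewrite /P absz_gt0 fx0; apply/asboolP.
  have [f_ge0|f_lt0] := leP 0 (f n x0); first by exists x0; rewrite // gez0_abs.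
  by exists (- x0); rewrite ?raddfN ?ltz0_abs //; exact: AN.
case: (ex_minnP exP) => d /andP[d_gt0 /asboolP[a Aa fa]] dmin.
pose A' := [set x | A x /\ f n x = 0].
have [||x [Ax fnx] fx|B [BA' BD Bfree]] := IHn A'.
- by split=> //; rewrite raddf0.
- by move=> x y [Ax fx] [Ay fy]; split; [exact: AB | rewrite raddfB fx fy
  subr0].
- apply: fA => // i; rewrite ltnS leq_eqVlt => /predU1P[->|] //; exact: fx.
exists (a |` B); split=> [x [->//|/BA'[]//]|D D0 DB BsubD x Ax|s c us sB sum0].
- have Da : D a by apply: BsubD; left.
  pose q := (f n x %/ d%:Z)%Z.
  have faq : f n (a *~ q) = d%:Z * q by rewrite raddfMz fa -mulrzr intz.
  have Ay : A (x - a *~ q) by apply/AB => //; exact: sub_closedMz.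
  have fy : f n (x - a *~ q) = (f n x %% d%:Z)%Z.
    by rewrite raddfB faq {1}(divz_eq (f n x) d) mulrC addrC addKr.
  have d0 : d%:Z != 0 by rewrite eqz_nat -lt0n.
  (* The remainder is a value of the last coordinate on [A] below the least positive one, so it
     vanishes. *)
  have fy0 : f n (x - a *~ q) = 0.
    apply/eqP; rewrite fy; apply/negPn/negP => r0.
    have r_ge0 := modz_ge0 (f n x) d0.
    have := dmin `|(f n x %% d)%Z|%N; rewrite /P absz_gt0 r0 /=.
    have -> : `[< exists2 y, A y & f n y = `|(f n x %% d)%Z|%N%:Z >].
      by apply/asboolP; exists (x - a *~ q); rewrite // fy gez0_abs.
    by move=> /(_ isT); rewrite leqNgt -ltz_nat gez0_abs // ltz_pmod // ltz_nat.
  suff: D (x - a *~ q - - (a *~ q)) by rewrite opprK subrK.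
  apply/DB.
    by apply: (BD D) => // y By; apply: BsubD; right.
  by rewrite -[- _]add0r; apply/DB => //; exact: sub_closedMz.
(* All other members of [s] lie in the kernel of the last coordinate, which isolates the coefficient
   of [a]. *)
have ca : a \in s -> c a = 0.
  move=> sa; have := congr1 (f n) sum0; rewrite raddf_sum raddf0.
  rewrite (bigD1_seq a) //= big_seq_cond big1 => [|b /andP[sb ba]].
    rewrite addr0 raddfMz fa -mulrzr intz => /eqP;
      rewrite mulf_eq0 => /orP[|/eqP//].
    by rewrite eqz_nat eqn0Ngt d_gt0.
  have /set_mem[eba|/BA'[_ fb]] := sB b sb; first by rewrite eba eqxx in ba.
  by rewrite raddfMz fb mul0rz.
pose s' := [seq b <- s | b != a].
have sum' : \sum_(b <- s') b *~ c b = 0.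
  rewrite big_filter -[LHS]addr0 -[RHS]sum0 [RHS](bigID (fun b => b != a)) /=.
  congr (_ + _); rewrite big_seq_cond big1 // => b /andP[sb /negPn/eqP ba].
  by rewrite ba ca ?mulr0z // -ba.
have s'B : {subset s' <= B}.
  move=> b; rewrite mem_filter => /andP[ba /sB/set_mem[eba|Bb]].
    by rewrite eba eqxx in ba.
  exact/mem_set.
move=> b sb; have [ba0|ba] := eqVneq b a; first by rewrite ba0 ca // -ba0.
by apply: (Bfree s') => //; rewrite ?filter_uniq // mem_filter ba.
Qed.
End FreeAbelian.

(** * Free centers *)

Section FreeCenter.
Variable G : groupType.

(** A total retraction of [cval], with default 0 off the center: central elements can be defined by
    formulas before their centrality is proved. *)
Definition cproj (x : G) : center G :=
  if pselect (forall y, commute x y) is left xC then mkCenter xC else 0.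

Lemma cvalKd x : (forall y, commute x y) -> cval (cproj x) = x.
Proof. by rewrite /cproj; case: pselect. Qed.

Lemma cprojK : cancel (@cval G) cproj.
Proof. by move=> w; apply: cval_inj; apply: cvalKd; exact: center_commute. Qed.

Lemma subgroup_center : subgroup (group_center [set: G]).
Proof.
split=> [|x y /center_subP[z ->] /center_subP[w ->]].
  by split=> // x _; rewrite mul1g mulg1.
by rewrite -cvalN -cvalD; split=> // u _; exact: center_commute.
Qed.

Lemma center_set z : group_center [set: G] (cval z).
Proof. by split=> // x _; exact: center_commute. Qed.

Lemma big_map_cval (s : seq (center G)) (c : G -> int) :
  (\prod_(b <- [seq cval w | w <- s]) zexpg b (c b))%g =
  cval (\sum_(w <- s) w *~ c (cval w)).
Proof.
by rewrite big_map cval_sum; apply: eq_bigr => w _; rewrite cvalMz.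
Qed.

(** The coordinates embed the center in Z^n, all of whose subgroups are free. *)
Lemma free_center_of_coordinates n (f : nat -> center G -> int) :
  (forall i, zmod_morphism (f i)) -> (forall z, (forall i, (i < n)%N -> f i z =
    0) -> z = 0) ->
  free_abelian (group_center [set: G]).
Proof.
move=> fB f_inj; split; first exact: subgroup_center.
  by move=> x y _ [_ yC]; rewrite yC.
pose F i : {additive center G -> int} :=
  HB.pack (f i) (GRing.isZmodMorphism.Build _ _ (f i) (fB i)).
have [||z _|B [_ genB indB]] := @free_of_coordinates (center G) n F setT => //.
  exact: f_inj.
exists [set cval w | w in B]; last first.
  move=> s c us sB; pose t := [seq cproj b | b <- s].
  have tK : [seq cval w | w <- t] = s.
    rewrite -map_comp map_id_in // => b /sB/set_mem[w _ <-] /=.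
    by rewrite cprojK.
  rewrite -tK big_map_cval -(@cval0 G) => /cval_inj sum0 b.
  case/mapP=> w tw ->; apply: (indB t (c \o (@cval G))) => //.
    by rewrite -(map_inj_uniq (@cval_inj G)) tK.
  move=> v tv; have /sB/set_mem[u Bu uv] : cval v \in s.
    by rewrite -tK map_f.
  by rewrite -(cval_inj uv); exact/mem_set.
apply/seteqP; split=> [x|x /center_subP[w ->]].
  apply: generated_min; first exact: subgroup_center.
  by move=> _ [w _ <-]; exact: center_set.
have gB := generated_subgroup [set cval w | w in B].
apply: (genB [set w | generated [set cval w | w in B] (cval w)]) => //=.
- by rewrite cval0; exact: gB.1.
- by move=> u v gu gv; rewrite cvalD cvalN; exact: gB.2.
- by move=> u Bu; apply: sub_generated; exists u.
Qed.

(** Doubling an element doubles its coefficients in a basis, so there is no 2-torsion. *)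
Lemma free_center_torsion : free_abelian (group_center [set: G]) ->
  forall z : center G, z + z = 0 -> z = 0.
Proof.
move=> [_ _ [B genB indB]] z.
(* [generated] is an intersection of subgroups; [span] makes its elements explicit as integer
   combinations of basis elements. *)
pose span := [set x | exists (s : seq (center G)) (c : center G -> int),
  [/\ uniq s, forall b, b \in s -> B (cval b)
    & x = cval (\sum_(b <- s) b *~ c b)]].
(* Padding with zero coefficients brings two combinations to a common support. *)
have widen (s u : seq (center G)) (c : center G -> int) :
    uniq s -> uniq u -> {subset s <= u} ->
    \sum_(b <- s) b *~ c b = \sum_(b <- u) b *~ (if b \in s then c b else 0).
  move=> us uu su; rewrite [RHS](bigID (mem s)) /= [X in _ = _ + X]big1 ?addr0.
    rewrite -[RHS]big_filter (perm_big [seq b <- u | b \in s]) /=.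
      by apply: eq_big_seq => b; rewrite mem_filter => /andP[->].
    apply: uniq_perm; rewrite ?filter_uniq // => b.
    by rewrite mem_filter andb_idr //; exact: su.
  by move=> b /negPf->.
have sub_span : subgroup span.
  split=> [|x y [s [c [us sB ->]]] [s' [c' [us' sB' ->]]]].
    by exists [::], (fun=> 0); rewrite big_nil.
  pose u := undup (s ++ s').
  have uu : uniq u by exact: undup_uniq.
  exists u, (fun b => (if b \in s then c b else 0) -
                      (if b \in s' then c' b else 0)); split=> //.
    by move=> b; rewrite mem_undup mem_cat => /orP[/sB|/sB'].
  rewrite -cvalN -cvalD; congr cval.
  rewrite (widen s u) ?(widen s' u) // -?sumrB; last 2 first.
  - by move=> b sb; rewrite mem_undup mem_cat sb orbT.
  - by move=> b sb; rewrite mem_undup mem_cat sb.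
  by apply: eq_bigr => b _; rewrite mulrzBr.
have Bspan : B `<=` span.
  move=> x Bx; have /center_subP[w xw] : group_center [set: G] x.
    by rewrite -genB; exact: sub_generated.
  exists [:: w], (fun=> 1); split=> //; last by rewrite big_seq1.
  by move=> b; rewrite inE => /eqP->; rewrite -xw.
have : span (cval z).
  by apply: (generated_min sub_span Bspan); rewrite genB; exact: center_set.
case=> s [c [us sB /cval_inj->]]; rewrite -big_split /= => sum0.
rewrite big_seq big1 // => w sw.
suff : c (cproj (cval w)) + c (cproj (cval w)) = 0.
  by rewrite cprojK => /eqP; rewrite -mulr2n mulrn_eq0 => /eqP ->;
    rewrite mulr0z.
apply: (indB [seq cval w | w <- s] (fun b => c (cproj b) + c (cproj b))).
- by rewrite map_inj_uniq //; exact: cval_inj.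
- by move=> _ /mapP[v /sB Bv ->]; exact/mem_set.
- rewrite big_map_cval -(@cval0 G); congr cval.
  apply: etrans sum0; apply: eq_bigr => v _.
  by rewrite cprojK mulrzDr.
- exact: map_f.
Qed.

End FreeCenter.

(** * The group of a semilattice *)

Section IntegerPowers.
Variable G : groupType.
Implicit Types (g h : G) (m n : int).

(** Writing integers as differences of naturals spares [zexpgD] a case analysis on signs. *)
Lemma zexpgB g (p q : nat) : zexpg g (p%:Z - q%:Z) = (g ^+ p / g ^+ q)%g.
Proof.
have [qp|pq] := leqP q p.
  by rewrite subzn // /= expgnFr.
rewrite -opprB subzn; last exact: ltnW.
have : (0 < q - p)%N by rewrite subn_gt0.
case def_d : (q - p)%N => [//|d] _; rewrite -NegzE /= -def_d.
by rewrite expgnFr ?(ltnW pq) // invgF.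
Qed.

Lemma zexpgD g m n : zexpg g (m + n) = (zexpg g m * zexpg g n)%g.
Proof.
have intB (k : int) : exists p q : nat, k = p%:Z - q%:Z.
  case: k => k; first by exists k, 0%N; rewrite subr0.
  by exists 0%N, k.+1; rewrite NegzE sub0r.
have [p [q ->]] := intB m; have [r [s ->]] := intB n.
rewrite addrACA -opprD -!PoszD !zexpgB (addnC q) !expgnDr invgM.
rewrite !mulgA; congr (_ * _)%g; rewrite -!mulgA; congr (_ * _)%g.
by apply: commuteV; exact: commuteX2.
Qed.

Lemma zexpgN g n : zexpg g (- n) = (zexpg g n)^-1%g.
Proof. by symmetry; apply: mulg1_eq; rewrite -zexpgD subrr. Qed.

Lemma zexpVg g n : zexpg g^-1%g n = (zexpg g n)^-1%g.
Proof. by case: n => n /=; rewrite expVgn. Qed.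

Lemma subgroup_zexpg (A : set G) g n : subgroup A -> A g -> A (zexpg g n).
Proof.
move=> sA Ag.
have AX k : A (g ^+ k)%g.
  by elim: k => [|k IHk]; [exact: sA.1 | rewrite expgS; exact: subgroupM].
by case: n => k /=; [exact: AX | apply: subgroupV].
Qed.

Lemma morph_zexpg (H : groupType) (f : G -> H) g n :
  {morph f : x y / (x * y)%g} -> f (zexpg g n) = zexpg (f g) n.
Proof.
move=> fM; have f1 : f 1%g = 1%g by apply: (mulIg (f 1%g)); rewrite -fM !mul1g.
have fX k : f (g ^+ k)%g = (f g ^+ k)%g.
  by elim: k => [|k IHk] //; rewrite !expgS fM IHk.
case: n => n //=; rewrite -fX; apply: (mulIg (f (g ^+ n.+1)%g)).
by rewrite -fM !mulVg.
Qed.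

Lemma zexpgJ (h g : G) n : zexpg (g ^ h)%g n = (zexpg g n ^ h)%g.
Proof. by case: n => n /=; rewrite ?conjVg conjXg. Qed.

End IntegerPowers.

(* The abstract situation of weyl_hat: x s stands for the generator attached to
   the root alpha_1 + s, and transl s is the product of two such reflections
   which acts on S as the translation by 2 s. *)
Section CoreGroup.
Variables (R : realType) (V : vectType R) (S : set V) (G : groupType) (x : V ->
  G).
Hypotheses (S0 : S 0)
  (SD2 : forall s t, S s -> S t -> S (s + t *+ 2))
  (SB2 : forall s t, S s -> S t -> S (s - t *+ 2))
  (xx : forall s, S s -> (x s * x s = 1)%g)
  (xJ : forall s t, S s -> S t -> (x s * x t * x s)%g = x (s *+ 2 - t))
  (xgen : generated [set x s | s in S] = setT).

Definition transl s := (x s * x 0)%g.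

Lemma semilatticeN s : S s -> S (- s).
Proof. by move=> Ss; have := SB2 Ss Ss; rewrite mulr2n opprD addNKr. Qed.

Lemma xV s : S s -> (x s)^-1%g = x s.
Proof. by move=> Ss; apply: mulg1_eq; exact: xx. Qed.

Lemma transl0 : transl 0 = 1%g.
Proof. exact: xx. Qed.

Lemma x_transl s : x s = (transl s * x 0)%g.
Proof. by rewrite /transl -mulgA xx // mulg1. Qed.

Lemma translJ s : S s -> (transl s ^ x 0)%g = (transl s)^-1%g.
Proof.
by move=> Ss; rewrite conjgE /transl invgM !xV // -!mulgA xx // mulg1.
Qed.

(** Conjugation by [g] moves [x s] to [x (s + l *+ 2)]. Stability of [S] in both directions is
    carried along so that shifts compose and invert, the relations between the [x s] being known on
    [S] only. *)
Definition shifts g l := forall s, S s ->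
  [/\ S (s + l *+ 2), S (s - l *+ 2) & (g * x s)%g = (x (s + l *+ 2)%R * g)%g].

Lemma shifts_transl u : S u -> shifts (transl u) u.
Proof.
move=> Su s Ss; split; [exact: SD2 | exact: SB2 | ].
(* The translation by 2u is the point reflection in 0 followed by the one in u. *)
have -> : s + u *+ 2 = u *+ 2 - (0 *+ 2 - s) by rewrite mul0rn sub0r opprK
  addrC.
have SNs : S (0 *+ 2 - s) by rewrite mul0rn sub0r; exact: semilatticeN.
rewrite -xJ // -xJ // /transl !mulgA.
by rewrite -(mulgA _ (x u) (x u)) xx // mulg1 -(mulgA _ (x 0) (x 0)) xx ?mulg1.
Qed.

Lemma shifts1 : shifts 1%g 0.
Proof. by move=> s Ss; rewrite mul0rn addr0 subr0 mul1g mulg1. Qed.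

Lemma shiftsM g h l m : shifts g l -> shifts h m -> shifts (g * h)%g (l + m).
Proof.
move=> gl hm s Ss; have [Sp Sm hx] := hm s Ss.
have -> : s + (l + m) *+ 2 = s + m *+ 2 + l *+ 2.
  by rewrite (addrC l) mulrnDl [LHS]addrA.
have -> : s - (l + m) *+ 2 = s - m *+ 2 - l *+ 2.
  by rewrite (addrC l) mulrnDl opprD [LHS]addrA.
have [Sp' _ gx] := gl _ Sp; have [_ Sm' _] := gl _ Sm; split=> //.
by rewrite -mulgA hx mulgA gx -mulgA.
Qed.

Lemma shiftsV g l : shifts g l -> shifts g^-1%g (- l).
Proof.
move=> gl s Ss; have [Sp Sm _] := gl s Ss; rewrite mulNrn opprK; split=> //.
have [_ _] := gl _ Sm; rewrite subrK => gx.
by apply: (mulgI g); rewrite mulgA mulgV mul1g mulgA gx mulgK.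
Qed.

Lemma shifts_prod (I : Type) (r : seq I) (F : I -> G) (l : I -> V) :
  (forall i, shifts (F i) (l i)) ->
  shifts (\prod_(i <- r) F i)%g (\sum_(i <- r) l i).
Proof.
move=> Fl; elim: r => [|i r IHr]; first by rewrite !big_nil; exact: shifts1.
by rewrite !big_cons; exact: shiftsM.
Qed.

(** A zero shift means commuting with all generators. The central elements below are recognised by
    the cancellation of their shifts. *)
Lemma shifts0_center g : shifts g 0 -> forall h, commute g h.
Proof.
move=> g0 h; suff : generated [set x s | s in S] `<=` [set y | commute g y].
  by apply; rewrite xgen.
apply: generated_min; first exact: subgroup_commute.
by move=> _ [s Ss <-]; have [_ _] := g0 s Ss; rewrite mul0rn addr0.
Qed.

Lemma shifts_commg g h l m : shifts g l -> shifts h m ->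
  forall k, commute [~ g, h]%g k.
Proof.
move=> gl hm; apply: shifts0_center.
have -> : 0 = - l + (- m + (l + m)) by rewrite addrA -opprD addNr.
by do ?[exact: shiftsV | exact: gl | exact: hm | apply: shiftsM].
Qed.

(* Conjugation by the involution x 0 inverts translations and fixes central
   elements, which computes the squares of the latter. *)
Lemma center_square (c : center G) s p : S s ->
  (cval c * transl s)%g = p -> cval (c + c) = (p * p ^ x 0)%g.
Proof.
move=> Ss <-; rewrite conjMg translJ // cvalD.
have -> : (cval c ^ x 0)%g = cval c.
  by apply/conjg_fixP/commgP; exact: center_commute.
rewrite -mulgA (mulgA (transl s)) -(center_commute c (transl s)) -mulgA.
by rewrite mulgV mulg1.
Qed.

(** * The central elements attached to a basis and a supporting class *)

Variables (nu : nat) (sigma : 'I_nu -> V) (supp : {set {set 'I_nu}}).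
Hypotheses (Ssigma : forall i, S (sigma i))
  (Ssupp : forall J, J \in supp -> S (tau sigma J)).

(* The commutator genc r s is twice geny r s when {r, s} is in supp, and equals
   it otherwise; this factor is the ratio 2 / delta(r, s). *)
Definition gena i := transl (sigma i).
Definition genP (J : {set 'I_nu}) := (\prod_(j <- enum J) gena j)%g.
Definition genz (J : {set 'I_nu}) := cproj (genP J * (transl (tau sigma
  J))^-1)%g.
Definition genc r s := cproj [~ gena r, gena s]%g.
Definition geny r s := if [set r; s]%SET \in supp then
  cproj (gena r * gena s * (transl (sigma r + sigma s))^-1)%g else genc r s.

Lemma gencE r s : (gena r * gena s = cval (genc r s) * (gena s * gena r))%g.
Proof.
have cC : forall k, commute [~ gena r, gena s]%g k.
  by apply: shifts_commg; apply: shifts_transl; exact: Ssigma.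
by rewrite /genc cvalKd // cC -commgC.
Qed.

Lemma genzE J : J \in supp ->
  (cval (genz J) * transl (tau sigma J))%g = genP J.
Proof.
move=> /Ssupp SJ; rewrite /genz cvalKd ?mulgVK //.
apply: shifts0_center; rewrite -(subrr (tau sigma J)); apply: shiftsM.
  rewrite /tau -big_enum; apply: shifts_prod => i.
  by apply: shifts_transl; exact: Ssigma.
by apply: shiftsV; exact: shifts_transl.
Qed.

Lemma tau2 r s : r != s -> tau sigma [set r; s]%SET = sigma r + sigma s.
Proof. by move=> rs; rewrite /tau big_setU1 ?inE //= big_set1. Qed.

Lemma genyE r s : [set r; s]%SET \in supp -> r != s ->
  (cval (geny r s) * transl (sigma r + sigma s))%g = (gena r * gena s)%g.
Proof.
move=> rs_supp rs; have /Ssupp := rs_supp; rewrite tau2 // => Srs.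
rewrite /geny rs_supp cvalKd ?mulgVK //.
apply: shifts0_center; rewrite -(subrr (sigma r + sigma s)).
apply: shiftsM; last by apply: shiftsV; exact: shifts_transl.
by apply: shiftsM; apply: shifts_transl; exact: Ssigma.
Qed.

(** In [center_square] with p = a_r a_s, the conjugate of p is a_r^-1 a_s^-1, which leaves the
    commutator. *)
Lemma geny_double r s : [set r; s]%SET \in supp -> r != s ->
  geny r s + geny r s = genc r s.
Proof.
move=> rs_supp rs; apply: cval_inj.
have /Ssupp := rs_supp; rewrite tau2 // => Srs.
rewrite (center_square Srs (genyE rs_supp rs)) conjMg !translJ //.
rewrite gencE -[transl (sigma r)]/(gena r) -[transl (sigma s)]/(gena s).
by rewrite -invgM mulgK.
Qed.

Definition spany (w : center G) : Prop := exists n : 'I_nu -> 'I_nu -> int,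
  w = \sum_(r < nu) \sum_(s < nu | (r < s)%N) geny r s *~ n r s.

Lemma spany0 : spany 0.
Proof.
by exists (fun _ _ => 0); rewrite big1 // => r _; rewrite big1.
Qed.

Lemma spanyB v w : spany v -> spany w -> spany (v - w).
Proof.
move=> [m ->] [n ->]; exists (fun r s => m r s - n r s).
rewrite -sumrB; apply: eq_bigr => r _; rewrite -sumrB.
by apply: eq_bigr => s _; rewrite mulrzBr.
Qed.

Lemma spanyN v : spany v -> spany (- v).
Proof. by move=> Yv; rewrite -[- v]add0r; apply: spanyB => //;
  exact: spany0. Qed.

Lemma spanyD v w : spany v -> spany w -> spany (v + w).
Proof. by move=> Yv /spanyN Yw; rewrite -[w]opprK; exact: spanyB. Qed.

Lemma spany_geny (r s : 'I_nu) : (r < s)%N -> spany (geny r s).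
Proof.
move=> rs; exists (fun i j => ((i == r) && (j == s) : nat)%:Z).
rewrite (bigD1 r) //= [X in _ + X]big1 ?addr0 => [|i ir].
  rewrite (bigD1 s) //= [X in _ + X]big1 ?addr0 ?eqxx ?mulr1z //.
  by move=> j /andP[_ /negPf->]; rewrite andbF mulr0z.
by rewrite big1 // => j _; rewrite (negPf ir) mulr0z.
Qed.

Lemma gencN r s : genc s r = - genc r s.
Proof.
apply/eqP; rewrite -addr_eq0; apply/eqP/cval_inj.
apply: (mulIg (gena s * gena r)%g); rewrite cvalD -mulgA -gencE -gencE.
by rewrite cval0 mul1g.
Qed.

Lemma genc0 r : genc r r = 0.
Proof.
apply: cval_inj; apply: (mulIg (gena r * gena r)%g).
by rewrite -gencE cval0 mul1g.
Qed.

Lemma spany_genc r s : spany (genc r s).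
Proof.
wlog rs : r s / (r < s)%N => [Yrs|].
  have [rs|sr|/val_inj->] := ltngtP r s; first exact: Yrs.
    by rewrite gencN; apply: spanyN; exact: Yrs.
  by rewrite genc0; exact: spany0.
have rs' : r != s by rewrite -val_eqE ltn_eqF.
have [rs_supp|rs_supp] := boolP ([set r; s]%SET \in supp).
  by rewrite -geny_double //; apply: spanyD; exact: spany_geny.
by have := spany_geny rs; rewrite /geny (negPf rs_supp).
Qed.

(** By [center_square] the double is a_1 ... a_k a_1^-1 ... a_k^-1, where a_1, ..., a_k are the
    factors of [genP J]; reordering the factors costs only commutators, which lie in [spany]. *)
Lemma spany_genz_double J : J \in supp -> spany (genz J + genz J).
Proof.
move=> Jsupp; have SJ := Ssupp Jsupp.
suff [w Yw Ew] : exists2 w, spany w &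
    cval w = (genP J * genP J ^ x 0)%g.
  suff <- : w = genz J + genz J by [].
  by apply: cval_inj; rewrite Ew (center_square SJ (genzE Jsupp)).
rewrite /genP; elim: (enum J) => [|j L [w Yw Ew]].
  by exists 0; [exact: spany0 | rewrite big_nil conj1g mulg1].
(* Here [v] collects the commutators met when [gena j] moves past the later factors. *)
have [v Yv Ev] : exists2 v, spany v &
    (gena j * \prod_(i <- L) gena i = cval v * (\prod_(i <- L) gena i * gena
      j))%g.
  elim: L {w Yw Ew} => [|i L [v Yv Ev]].
    by exists 0; [exact: spany0 | rewrite big_nil mulg1 !mul1g].
  exists (genc j i + v); first by apply: spanyD => //; exact: spany_genc.
  rewrite big_cons mulgA gencE -mulgA -(mulgA (gena i)) Ev cvalD -[RHS]mulgA.
  rewrite (mulgA (gena i)) -(center_commute v (gena i)) -(mulgA (cval v)).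
  by rewrite (mulgA (gena i)).
exists (v + w); first exact: spanyD.
rewrite !big_cons conjMg translJ ?Ev; last exact: Ssigma.
set p := (\prod_(i <- L) gena i)%g in Ew *.
rewrite cvalD Ew -[transl (sigma j)]/(gena j) -!(mulgA (cval v)).
by rewrite (mulgA _ (gena j)^-1%g) mulgK.
Qed.

(* Coefficients eps in {0, 1} suffice because genz J + genz J is in spany. *)
Definition spanC (w : center G) : Prop := exists (eps : {set 'I_nu} -> bool),
  exists2 v, spany v & w = \sum_(J in Esupp supp) genz J *+ eps J + v.

Lemma spanC_spany v : spany v -> spanC v.
Proof.
by move=> Yv; exists xpred0, v => //; rewrite big1 ?add0r.
Qed.

Lemma Esupp_supp J : J \in Esupp supp -> J \in supp.
Proof. by rewrite inE => /andP[]. Qed.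

Lemma spany_sum (I : Type) (r : seq I) (P : pred I) F :
  (forall i, P i -> spany (F i)) -> spany (\sum_(i <- r | P i) F i).
Proof. by move=> YF; apply: big_ind => //; [exact: spany0 | exact: spanyD]. Qed.

Lemma spanCB v w : spanC v -> spanC w -> spanC (v - w).
Proof.
move=> [e [v' Yv ->]] [f [w' Yw ->]].
(* On bits, e - f = (e xor f) - 2 (not e and f), and the doubled elements are absorbed by
   [spany]. *)
exists (fun J => e J (+) f J).
exists (v' - w' - \sum_(J in Esupp supp) (genz J + genz J) *+ (~~ e J && f J)).
  apply: spanyB; first exact: spanyB.
  apply: spany_sum => J /Esupp_supp /spany_genz_double Y2.
  by case: (~~ e J && f J); rewrite ?mulr1n ?mulr0n //; exact: spany0.
rewrite opprD addrACA [RHS]addrCA [RHS]addrC; congr (_ + _).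
rewrite -!sumrB; apply: eq_bigr => J _.
case: (e J); case: (f J) => /=; rewrite ?mulr1n ?mulr0n ?subrr ?subr0 ?sub0r //.
by rewrite opprD addrA subrr sub0r.
Qed.

Lemma spanC_genz J : J \in Esupp supp -> spanC (genz J).
Proof.
move=> EJ; exists (pred1 J), 0; first exact: spany0.
rewrite addr0 (bigD1 J) //= eqxx mulr1n big1 ?addr0 // => K /andP[_ /negPf->].
by rewrite mulr0n.
Qed.

(** * Congruence modulo the central subgroup [spanC] *)

Definition eqC g h := exists2 c, spanC c & g = (cval c * h)%g.

Lemma spanC0 : spanC 0. Proof. exact/spanC_spany/spany0. Qed.

Lemma spanCN c : spanC c -> spanC (- c).
Proof. by rewrite -sub0r; apply: spanCB; exact: spanC0. Qed.

Lemma spanCD c d : spanC c -> spanC d -> spanC (c + d).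
Proof. by move=> Cc /spanCN Cd; rewrite -[d]opprK; exact: spanCB. Qed.

Lemma eqC_refl g : eqC g g.
Proof. by exists 0; [exact: spanC0 | rewrite mul1g]. Qed.

Lemma eqC_sym g h : eqC g h -> eqC h g.
Proof.
by move=> [c Cc ->]; exists (- c); [exact: spanCN | rewrite cvalN mulKg].
Qed.

Lemma eqC_trans h g k : eqC g h -> eqC h k -> eqC g k.
Proof.
by move=> [c Cc ->] [d Cd ->]; exists (c + d); [exact: spanCD | rewrite mulgA].
Qed.

Lemma eqCM g g' h h' : eqC g g' -> eqC h h' -> eqC (g * h)%g (g' * h')%g.
Proof.
move=> [c Cc ->] [d Cd ->]; exists (c + d); first exact: spanCD.
rewrite cvalD -!mulgA; congr (_ * _)%g.
by rewrite !mulgA (center_commute d g').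
Qed.

Lemma eqCV g h : eqC g h -> eqC g^-1%g h^-1%g.
Proof.
move=> [c Cc ->]; exists (- c); first exact: spanCN.
by rewrite invgM -cvalN (center_commute (- c)).
Qed.

Lemma eqC_commute_subgroup g : subgroup [set h | eqC (g * h)%g (h * g)%g].
Proof.
split=> [|h k /= gh gk]; first by rewrite /= mulg1 mul1g; exact: eqC_refl.
have gkV : eqC (g * k^-1)%g (k^-1 * g)%g.
  apply: eqC_sym; have := eqCM (eqCM (eqC_refl k^-1%g) gk) (eqC_refl k^-1%g).
  by rewrite mulgA mulgK mulgA mulVg mul1g.
rewrite mulgA; apply: eqC_trans (eqCM gh (eqC_refl _)) _.
by rewrite -!mulgA; apply: eqCM (eqC_refl _) gkV.
Qed.

(** Two [gena] commute up to some [genc], which lies in [spanC]; one induction on each side extends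
    this to the subgroup they generate. *)
Lemma gensub_commute g h : generated (range gena) g ->
  generated (range gena) h -> eqC (g * h)%g (h * g)%g.
Proof.
move=> Ag Ah; suff : generated (range gena) `<=` [set k | eqC (g * k)%g (k *
  g)%g].
  exact.
apply: generated_min; first exact: eqC_commute_subgroup.
move=> _ [i _ <-] /=; apply: eqC_sym.
suff : generated (range gena) `<=`
    [set k | eqC (gena i * k)%g (k * gena i)%g] by exact.
apply: generated_min; first exact: eqC_commute_subgroup.
move=> _ [j _ <-]; exists (genc i j); last exact: gencE.
exact/spanC_spany/spany_genc.
Qed.

(** * Ordered monomials in the translations and the normal form *)

Definition genT (L : seq 'I_nu) (l : 'I_nu -> int) : G :=
  (\prod_(i <- L) zexpg (gena i) (l i))%g.

Lemma genT_sub L l : generated (range gena) (genT L l).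
Proof.
have sA := generated_subgroup (range gena).
apply: (subgroup_prod sA) => i _; apply: (subgroup_zexpg _ sA).
by apply: sub_generated; exists i.
Qed.

Lemma genTM L l m :
  eqC (genT L l * genT L m)%g (genT L (fun i => l i + m i)).
Proof.
elim: L => [|i L IHL].
  by rewrite /genT !big_nil mul1g; exact: eqC_refl.
rewrite /genT !big_cons -!/(genT _ _) zexpgD.
set p := zexpg _ _; set q := zexpg _ (m i).
have Aq : generated (range gena) q.
  apply: (subgroup_zexpg _ (generated_subgroup _)).
  by apply: sub_generated; exists i.
rewrite -!mulgA; apply: eqCM; first exact: eqC_refl.
rewrite !mulgA; apply: eqC_trans (eqCM (gensub_commute (genT_sub L l) Aq)
  (eqC_refl _)) _.
by rewrite -mulgA; apply: eqCM => //; exact: eqC_refl.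
Qed.

Lemma genT0 L l : (forall i, l i = 0) -> genT L l = 1%g.
Proof. by move=> l0; rewrite /genT big1 // => i _; rewrite l0. Qed.

Lemma eq_genT L l m : l =1 m -> genT L l = genT L m.
Proof. by move=> lm; apply: eq_bigr => i _; rewrite lm. Qed.

Lemma genTV L l : eqC (genT L l)^-1%g (genT L (fun i => - l i)).
Proof.
have := eqCM (eqC_refl (genT L l)^-1%g) (genTM L l (fun i => - l i)).
rewrite mulKg (@genT0 _ (fun i => _ - _)) ?mulg1; first exact: eqC_sym.
by move=> i; rewrite subrr.
Qed.

Lemma genTJ L l : (genT L l ^ x 0)%g = genT L (fun i => - l i).
Proof.
rewrite /genT conjg_prod; apply: eq_bigr => i _.
by rewrite -zexpgJ translJ ?zexpVg ?zexpgN //; exact: Ssigma.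
Qed.

Lemma genPT J : genP J = genT (enum 'I_nu) (fun i => (i \in J : nat)%:Z).
Proof.
rewrite /genP /genT /enum_mem big_filter big_mkcond [RHS]big_filter /=.
by apply: eq_bigr => i _; case: (i \in J).
Qed.

Lemma genP1 r : genP [set r]%SET = gena r.
Proof. by rewrite /genP enum_set1 big_seq1. Qed.

(** By size of [J]: from three elements on the discrepancy is [genz J]; for a pair it comes from
    [geny r s] and a reordering; below that there is none. *)
Lemma transl_tauT J : J \in supp ->
  eqC (transl (tau sigma J))
      (genT (enum 'I_nu) (fun i => (i \in J : nat)%:Z)).
Proof.
move=> Jsupp; have [J3|] := leqP 3 #|J|.
  rewrite -genPT -(genzE Jsupp); apply: eqC_sym; exists (genz J) => //.
  by apply: spanC_genz; rewrite inE Jsupp.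
rewrite ltnS leq_eqVlt => /orP[/cards2P[r [s [rs defJ]]]|].
  wlog lt_rs : r s rs defJ / (r < s)%N.
    move=> main; have [|lt_sr|/val_inj rs'] := ltngtP r s; first exact: main.
      by apply: (main s r) => //; rewrite 1?eq_sym // finset.setUC.
    by rewrite rs' eqxx in rs.
  rewrite defJ in Jsupp *; apply: eqC_trans (_ : eqC (gena r * gena s)%g _).
    apply: eqC_sym; exists (geny r s); first exact/spanC_spany/spany_geny.
    by rewrite tau2 // (genyE Jsupp).
  rewrite -(genP1 r) -(genP1 s) !genPT; apply: eqC_trans (genTM _ _ _) _.
  rewrite (@eq_genT _ _ (fun i => (i \in [set r; s]%SET : nat)%:Z)).
    exact: eqC_refl.
  move=> i; rewrite !inE; case: (eqVneq i r) => [->|_]; last by rewrite add0r.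
  by rewrite (negPf rs).
rewrite ltnS leq_eqVlt => /orP[/cards1P[r ->]|].
  by rewrite -genPT genP1 /tau big_set1; exact: eqC_refl.
rewrite ltnS leqn0 cards_eq0 => /eqP->; rewrite -genPT /genP enum_set0 big_nil.
by rewrite /tau big_set0 transl0; exact: eqC_refl.
Qed.

(** The subgroup contains x_0 and the x_(sigma_i), hence the translations by 2 sigma_i, which carry
    x_(tau_J) to every x_(tau_J + 2l) with l in the lattice. *)
Lemma generated_tau : finset.set0 \in supp ->
  (forall i, [set i]%SET \in supp) ->
  (forall s, S s -> exists2 J, J \in supp &
    exists2 l, zspan (range sigma) l & s = tau sigma J + l *+ 2) ->
  generated [set x (tau sigma J) | J in [set` supp]] = setT.
Proof.
move=> supp0 supp1 S_tau; set X := generated _.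
have sX : subgroup X by exact: generated_subgroup.
have Xtau J : J \in supp -> X (x (tau sigma J)).
  by move=> Jsupp; apply: sub_generated; exists J.
have Xtransl i : X (transl (sigma i)).
  apply: (subgroupM sX) => //.
    by have := Xtau _ (supp1 i); rewrite /tau big_set1.
  by have := Xtau _ supp0; rewrite /tau big_set0.
(* Both signs are carried so that [D] is closed under differences, as induction on the Z-span
   requires. *)
pose D l := forall s, S s -> [/\ S (s + l *+ 2), S (s - l *+ 2),
  X (x s) -> X (x (s + l *+ 2)) & X (x s) -> X (x (s - l *+ 2))].
suff DL l : zspan (range sigma) l -> D l.
  apply/seteqP; split=> // g _; suff : generated [set x s | s in S] `<=` X.
    by apply; rewrite xgen.
  apply: (generated_min sX) => _ [s /S_tau[J Jsupp [l /DL Dl ->]] <-].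
  by have [_ _ + _] := Dl _ (Ssupp Jsupp); apply; exact: Xtau.
move: l; apply: smallest_sub.
  split=> [s Ss|l m Dl Dm s Ss]; first by rewrite mul0rn addr0 subr0.
  rewrite mulrnBl opprB; have [Sp Sm Xp Xm] := Dl s Ss.
  have [_ S1 _ X1] := Dm _ Sp; have [S2 _ X2 _] := Dm _ Sm.
  have -> : s + (l *+ 2 - m *+ 2) = s + l *+ 2 - m *+ 2 by rewrite [LHS]addrA.
  have -> : s + (m *+ 2 - l *+ 2) = s - l *+ 2 + m *+ 2.
    by rewrite [LHS]addrCA [LHS]addrC.
  split=> // Xs.
    by apply: X1; exact: Xp.
  by apply: X2; exact: Xm.
move=> _ [i _ <-] s Ss; split; [exact: SD2 | exact: SB2 | |] => Xs.
  have [_ _] := shifts_transl (Ssigma i) Ss => /(congr1 (fun g => g * (transl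
    (sigma i))^-1)%g).
  rewrite mulgK => <-; apply: (subgroupM sX) => //; last exact: (subgroupV sX).
  exact: (subgroupM sX).
have [_ _] := shiftsV (shifts_transl (Ssigma i)) Ss.
rewrite mulNrn => /(congr1 (fun g => g * (transl (sigma i)))%g).
rewrite mulgVK => <-; apply: (subgroupM sX) => //; apply: (subgroupM sX) => //.
exact: (subgroupV sX).
Qed.

Hypothesis xgen_tau :
  generated [set x (tau sigma J) | J in [set` supp]] = setT.

(** As x_0 inverts the translations, monomials times a power of x_0 form a subgroup modulo [spanC],
    and it contains the generators. *)
Lemma normal_form k : exists l (e : bool),
  eqC k (genT (enum 'I_nu) l * x 0 ^+ e)%g.
Proof.
pose D := [set k | exists l (e : bool),
  eqC k (genT (enum 'I_nu) l * x 0 ^+ e)%g].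
suff : generated [set x (tau sigma J) | J in [set` supp]] `<=` D.
  by apply; rewrite xgen_tau.
apply: generated_min; last first.
  move=> _ [J /= Jsupp <-]; exists (fun i => (i \in J : nat)%:Z), true.
  rewrite x_transl expg1; apply: eqCM; last exact: eqC_refl.
  exact: transl_tauT.
split=> [|g h [l [e gl]] [m [f hm]]].
  exists (fun=> 0), false; rewrite genT0 // mul1g; exact: eqC_refl.
(* The second monomial is inverted once, and once more when an odd power of x_0 passes through
   it. *)
pose m' i := if e (+) f then m i else - m i.
exists (fun i => l i + m' i), (e (+) f).
apply: eqC_trans (eqCM gl (eqCV hm)) _; rewrite invgM.
set Tl := genT _ l; set Tm := genT _ m.
have -> : (Tl * x 0 ^+ e * ((x 0 ^+ f)^-1 * Tm^-1) =
           Tl * (x 0 ^+ (e (+) f) * Tm^-1))%g.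
  rewrite -mulgA; congr (_ * _)%g; rewrite mulgA; congr (_ * _)%g.
  by case: e {gl m'}; case: f {hm}; rewrite /= ?expg0 ?expg1 ?invg1 ?mulgV
    ?mulg1 ?mul1g ?xV.
have step : eqC (x 0 ^+ (e (+) f) * Tm^-1)%g
                (genT (enum 'I_nu) m' * x 0 ^+ (e (+) f))%g.
  apply: eqC_trans (eqCM (eqC_refl _) (genTV _ _)) _.
  rewrite /m'; case: (e (+) f); last by rewrite expg0 mul1g mulg1;
    exact: eqC_refl.
  by rewrite expg1 -genTJ -conjgC; exact: eqC_refl.
apply: eqC_trans (eqCM (eqC_refl _) step) _.
rewrite mulgA; apply: eqCM; last exact: eqC_refl.
exact: genTM.
Qed.

End CoreGroup.

(** * Generators of the presented group *)

Section PresentedGenerators.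
Variables (X : choiceType) (rels : set (word X)).
Local Notation gen := (presented_gen rels).

Lemma cls_cat u v : cls rels (u ++ v) = (cls rels u * cls rels v)%g.
Proof.
by symmetry; apply: cls_eq; apply: word_equiv_cat; exact: repr_cls.
Qed.

Lemma cls_inv x : cls rels [:: (x, true)] = (gen x)^-1%g.
Proof.
symmetry; apply: mulg1_eq; rewrite -cls_cat.
exact/cls_eq/(word_equiv_cancel rels [::] [::] x false).
Qed.

Lemma cls_relator r : rels r -> cls rels r = 1%g.
Proof.
move=> rr; apply: cls_eq.
by have := word_equiv_relator [::] [::] rr; rewrite cats0.
Qed.

Lemma presented_generated : generated (range gen) = setT.
Proof.
apply/seteqP; split=> // k _; set A := generated _.
have sA : subgroup A := generated_subgroup _.
rewrite -[k]reprK; change (A (cls rels (repr k))).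
elim: (repr k) => [|[x b] u IHu]; first exact: sA.1.
rewrite -cat1s cls_cat; apply: (subgroupM sA) => //.
have Ax : A (gen x) by apply: sub_generated; exists x.
by case: b; [rewrite cls_inv; exact: (subgroupV sA) | exact: Ax].
Qed.

End PresentedGenerators.

(** * Generators of the presented group indexed by the semilattice *)

Section HatGenerators.
Variables (R : realType) (V0 : vectType R) (S : set V0).
Hypothesis semS : semilattice S.

Local Notation hgen := (presented_gen (@conjugation_relators R V0 S)).

Lemma alpha1D s : alpha1 V0 + isotropic s = (1, s).
Proof. by congr pair; rewrite ?addr0 ?add0r. Qed.

Lemma alpha1N s : - alpha1 V0 + isotropic s = (-1, s).
Proof. by congr pair; rewrite /= ?addr0 ?oppr0 ?add0r. Qed.

Lemma root_subproof s : S s -> (1, s) \in nonisotropic_roots S.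
Proof. by move=> Ss; apply/mem_set; exists s => //; left; rewrite alpha1D. Qed.

Lemma rootN_subproof s : S s -> (-1, s) \in nonisotropic_roots S.
Proof. by move=> Ss; apply/mem_set; exists s => //; right; rewrite alpha1N. Qed.

Definition root s (Ss : S s) : nonisotropic_roots S :=
  exist _ ((1, s) : rootspace V0) (root_subproof Ss).

Definition rootN s (Ss : S s) : nonisotropic_roots S :=
  exist _ ((-1, s) : rootspace V0) (rootN_subproof Ss).

(** The value 1 outside [S] is a default. The roots with -alpha_1 give no further generators, by
    [hgen_opp]. *)
Definition hatx (s : V0) : weyl_hat S :=
  if pselect (S s) is left Ss then hgen (root Ss) else 1%g.

Lemma hatxE s (Ss : S s) : hatx s = hgen (root Ss).
Proof.
by rewrite /hatx; case: pselect => // Ss'; congr hgen; exact: val_inj.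
Qed.

Lemma hgen_involution a : (hgen a * hgen a = 1)%g.
Proof.
rewrite -cls_cat; apply: cls_relator; left; exists a => //.
Qed.

Lemma hgen_conj a b c : val c = root_reflection (val a) (val b) ->
  (hgen a * hgen b * hgen a)%g = hgen c.
Proof.
move=> abc; apply: divg1_eq.
have : conjugation_relators (conjugation_relator a b c).
  by right; exists a, b, c; split.
move/cls_relator; rewrite -[conjugation_relator a b c]/([:: (a, false)] ++
  [:: (b, false)] ++ [:: (a, false)] ++ [:: (c, true)]).
by rewrite !cls_cat cls_inv !mulgA.
Qed.

(** Since w_a(a) = -a, the conjugation relation of a root with itself identifies the generators of a
    and -a. *)
Lemma hgen_opp a b : val b = - val a -> hgen b = hgen a.
Proof.
move=> ab; rewrite -(@hgen_conj a a b) ?hgen_involution ?mul1g //.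
rewrite ab /root_reflection (@nonisotropic_root_form _ _ S).
  by rewrite scaler_nat mulr2n opprD addNKr.
exact/set_mem/valP.
Qed.

Let SN : forall s, S s -> S (- s) := semilatticeN (semilatticeB2 semS).

Lemma hgen_hatx a : exists2 s, S s & hgen a = hatx s.
Proof.
have [s Ss] : nonisotropic_roots S (val a) by exact/set_mem/valP.
rewrite alpha1D alpha1N => -[Ea|Ea].
  exists s => //; rewrite (hatxE Ss); congr hgen; exact: val_inj.
exists (- s); first exact: SN.
rewrite (hatxE (SN Ss)); apply: hgen_opp; rewrite Ea.
by congr pair; rewrite opprK.
Qed.

Lemma hatx_involution s : S s -> (hatx s * hatx s = 1)%g.
Proof. by move=> Ss; rewrite (hatxE Ss) hgen_involution. Qed.

(** The reflection in alpha_1 + s sends alpha_1 + t to -alpha_1 + t - 2s, the opposite of alpha_1 +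
    2s - t. *)
Lemma hatxJ s t : S s -> S t ->
  (hatx s * hatx t * hatx s)%g = hatx (s *+ 2 - t).
Proof.
move=> Ss St.
have Sts : S (t - s *+ 2) by exact: semilatticeB2.
have Sst : S (s *+ 2 - t) by rewrite -opprB; exact: SN.
rewrite (hatxE Ss) (hatxE St) (hatxE Sst) (@hgen_conj _ _ (rootN Sts)).
  by apply: hgen_opp; congr pair; rewrite /= opprB.
rewrite /root_reflection /root_form /= !mul1r scaler_nat.
by congr pair; rewrite /= opprD addNKr.
Qed.

Lemma hatx_generated : generated [set hatx s | s in S] = setT.
Proof.
apply/seteqP; split=> // k _; have : generated (range hgen) k.
  by rewrite presented_generated.
apply: generated_min; first exact: generated_subgroup.
move=> _ [a _ <-]; have [s Ss ->] := hgen_hatx a.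
by apply: sub_generated; exists s.
Qed.

Lemma psi_hatx s : S s -> forall a v f, val (psi (hatx s)) ((a, v), f) =
  ((- a - f s, v - (a * 2 + f s) *: s), f) :> hyperspace V0.
Proof.
move=> Ss a v f; rewrite (hatxE Ss) psi_gen /= hyper_reflectionE.
rewrite /hyper_form /root_form /= zero_lfunE addr0 mulr1.
congr pair; [congr pair|] => /=.
- by rewrite /GRing.scale /=; ring.
- by rewrite scaler0 subr0.
Qed.

End HatGenerators.

(** * Action of the Weyl group *)

Section WeylGeometry.
Variables (R : realType) (V0 : vectType R) (S : set V0).
Hypothesis semS : semilattice S.

Local Notation orth := (orthogonal_group (@hyper_form R V0)).
Local Notation rfl s := (psi (hatx S s)).

Definition act (g : orth) : hyperspace V0 -> hyperspace V0 := val g.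

Lemma actM g h u : act (g * h)%g u = act g (act h u).
Proof. by rewrite /act /= comp_lfunE. Qed.

Lemma act1 u : act 1%g u = u.
Proof. by rewrite /act /= id_lfunE. Qed.

Lemma act_inj g h : act g =1 act h -> g = h.
Proof. by move=> gh; apply/val_inj/lfunP. Qed.

Lemma act_form g u v : hyper_form (act g u) (act g v) = hyper_form u v.
Proof. by have [_] := Defs.orthogonalP g; apply. Qed.

Lemma act_linear g k u v : act g (k *: u + v) = k *: act g u + act g v.
Proof. exact: linearP. Qed.

Lemma psi_reflection (a : nonisotropic_roots S) : exists2 s, S s & reflection a
  = rfl s.
Proof.
by have [s Ss Ea] := hgen_hatx semS a; exists s => //; rewrite -Ea psi_gen.
Qed.

Lemma psi1 : psi (1%g : weyl_hat S) = 1%g.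
Proof. by apply: (mulIg (psi (1%g : weyl_hat S)));
  rewrite -psiM mulg1 mul1g. Qed.

Lemma weyl_ind (P : set orth) : P 1%g ->
  (forall s g, S s -> P g -> P (rfl s * g)%g) -> weyl_group S `<=` P.
Proof.
move=> P1 PS; apply: generated_involutions_ind => //.
  move=> _ [a _ <-]; have [s Ss ->] := psi_reflection a.
  by rewrite -psiM hatx_involution // psi1.
by move=> _ g [a _ <-] Pg; have [s Ss ->] := psi_reflection a; exact: PS.
Qed.

Lemma psiV (k : weyl_hat S) : psi k^-1%g = (psi k)^-1%g.
Proof. by symmetry; apply: mulg1_eq; rewrite -psiM mulgV psi1. Qed.

Lemma psi_preim_subgroup (A : set orth) : subgroup A ->
  subgroup [set k : weyl_hat S | A (psi k)].
Proof.
by move=> sA; split=> [|x y Ax Ay] /=; rewrite ?psi1 ?psiM ?psiV;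
  exact: sA.1 || exact: sA.2.
Qed.

Lemma weyl_psi (k : weyl_hat S) : weyl_group S (psi k).
Proof.
suff : generated (range (presented_gen (@conjugation_relators R V0 S)))
    `<=` [set k | weyl_group S (psi k)].
  by apply; rewrite presented_generated.
apply: generated_min; first exact/psi_preim_subgroup/generated_subgroup.
by move=> _ [a _ <-] /=; rewrite psi_gen; apply: sub_generated; exists a.
Qed.

Lemma psi_onto g : weyl_group S g -> exists k : weyl_hat S, psi k = g.
Proof.
move: g; apply: weyl_ind; first by exists 1%g; exact: psi1.
by move=> s _ Ss [k <-]; exists (hatx S s * k)%g; exact: psiM.
Qed.

Lemma act_rfl s a v (f : 'Hom(V0, R^o)) : S s ->
  act (rfl s) ((a, v), f) = ((- a - f s, v - (a * 2 + f s) *: s), f).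
Proof. by move=> Ss; exact: psi_hatx. Qed.

Lemma weyl_fix g : weyl_group S g ->
  forall v, act g ((0, v), 0) = ((0, v), 0).
Proof.
move: g; apply: weyl_ind => [v|s g Ss IHg v]; first exact: act1.
by rewrite actM IHg act_rfl // zero_lfunE mul0r addr0 scale0r !subr0 oppr0.
Qed.

Lemma weyl_dual g : weyl_group S g -> forall u, (act g u).2 = u.2.
Proof.
move: g; apply: weyl_ind => [u|s g Ss IHg u]; first by rewrite act1.
by rewrite actM; move: (IHg u); case: (act g u) => [[a v] f] <-;
  rewrite act_rfl.
Qed.

Lemma rfl_inj s t : S s -> S t -> rfl s = rfl t -> s = t.
Proof.
move=> Ss St /(congr1 (fun g => act g ((1, 0), 0))).
rewrite !act_rfl // !zero_lfunE !addr0 !mul1r !sub0r => -[].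
by move=> /oppr_inj; apply: scalerI; rewrite pnatr_eq0.
Qed.

Definition dualpart (g : orth) (f : 'Hom(V0, R^o)) : V0 :=
  (act g ((0, 0), f)).1.2.

(** The shape of a Heisenberg element: [l] is its translation part, and the rest of the action is
    recorded by [dualpart g]. *)
Definition translation (g : orth) (l : V0) := forall a v f,
  act g ((a, v), f) = ((a - f l, v + (a * 2) *: l + dualpart g f), f).

Lemma translationM g h l m : translation g l -> translation h m ->
  translation (g * h)%g (l + m) /\ forall f,
  dualpart (g * h)%g f = dualpart h f - (f m * 2) *: l + dualpart g f.
Proof.
move=> gl hm.
have ghE a v f : act (g * h)%g ((a, v), f) =
  ((a - f (l + m), v + (a * 2) *: (l + m) +
    (dualpart h f - (f m * 2) *: l + dualpart g f)), f).
  rewrite actM hm gl; congr pair; congr pair.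
    by rewrite linearD /= opprD addrA addrAC.
  by rewrite mulrBl scalerBl scalerDr [LHS](AC (3*2*1) ((1*(4*2))*((3*5)*6))).
have dE f : dualpart (g * h)%g f = dualpart h f - (f m * 2) *: l + dualpart g f.
  by rewrite {1}/dualpart ghE /= mul0r scale0r !add0r.
by split=> // a v f; rewrite ghE dE.
Qed.

Lemma translation_transl s : S s ->
  translation (psi (transl (hatx S) s)) s /\
  forall f, dualpart (psi (transl (hatx S) s)) f = - (f s *: s).
Proof.
move=> Ss; have S0 := semilattice0 semS.
have tE a v f : act (psi (transl (hatx S) s)) ((a, v), f) =
    ((a - f s, v + (a * 2) *: s - f s *: s), f).
  rewrite /transl psiM actM !act_rfl // linear0 subr0 addr0 scaler0 subr0 opprK.
  by rewrite mulNr scalerDl scaleNr opprD opprK addrA.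
have dE f : dualpart (psi (transl (hatx S) s)) f = - (f s *: s).
  by rewrite /dualpart tE /= mul0r scale0r !add0r.
by split=> // a v f; rewrite tE dE.
Qed.

End WeylGeometry.

Lemma oppr_fixed (K : numFieldType) (V : lmodType K) (v : V) :
  - v = v -> v = 0.
Proof.
move/eqP; rewrite eq_sym -subr_eq0 opprK -mulr2n -scaler_nat scaler_eq0.
by rewrite pnatr_eq0 => /eqP.
Qed.

(** * Coordinates on the Weyl group and its center *)

Section WeylCoordinates.
Variables (R : realType) (V0 : vectType R) (S : set V0) (nu : nat).
Variable sigma : 'I_nu -> V0.
Hypotheses (semS : semilattice S) (Ssigma : forall i, S (sigma i)).
Hypotheses (nu_gt0 : (0 < nu)%N) (dimV0 : \dim {:V0} = nu)
  (sigma_span : forall s, S s -> zspan (range sigma) s).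

Local Notation orth := (orthogonal_group (@hyper_form R V0)).
Local Notation rfl s := (psi (hatx S s)).
Local Notation X := [tuple sigma i | i < nu].

Lemma sigma_basis : basis_of fullv X.
Proof.
have spanX : <<X>>%VS = fullv.
  apply: (semilattice_span semS) => s /sigma_span; move: s.
  apply: smallest_sub; first by split=> [|x y Xx Xy] /=;
    [exact: mem0v | exact: rpredB].
  move=> _ [i _ <-] /=; apply: memv_span; apply/mapP.
  by exists i; rewrite ?mem_enum.
by rewrite basisEdim spanX subvv dimV0 size_tuple leqnn.
Qed.

Definition lam i : 'Hom(V0, R^o) := linfun (coord X i : V0 -> R^o).

Lemma lamE i v : lam i v = coord X i v.
Proof. by rewrite /lam lfunE. Qed.

Lemma lam_sigma i j : lam i (sigma j) = (i == j)%:R.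
Proof.
have -> : sigma j = X`_j by rewrite -tnth_nth tnth_mktuple.
by rewrite lamE coord_free ?(basis_free sigma_basis) // eq_sym.
Qed.

Lemma lam_sum v : v = \sum_i lam i v *: sigma i.
Proof.
rewrite {1}(coord_basis sigma_basis (memvf v)); apply: eq_bigr => i _.
by rewrite lamE -tnth_nth tnth_mktuple.
Qed.

Lemma hom_sum (f : 'Hom(V0, R^o)) : f = \sum_i f (sigma i) *: lam i.
Proof.
apply/lfunP => v; rewrite {1}(lam_sum v) linear_sum sum_lfunE.
by apply: eq_bigr => i _; rewrite linearZ scale_lfunE /GRing.scale /= mulrC.
Qed.

Lemma lam_inj v : (forall i, lam i v = 0) -> v = 0.
Proof.
by move=> v0; rewrite (lam_sum v) big1 // => i _; rewrite v0 scale0r.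
Qed.

(* For r < s this is the (r, s) entry of a Heisenberg group in upper
   unitriangular form (see bformM). On translations by 0 it is additive and is
   the coordinate on sigma_r /\ sigma_s. *)
Definition bform r s (g : orth) : R := - lam r (dualpart g (lam s)).

Lemma bformM r s g h l m : translation g l -> translation h m ->
  bform r s (g * h)%g = bform r s g + bform r s h + 2 * (lam r l * lam s m).
Proof.
move=> gl hm; have [_ dE] := translationM gl hm.
rewrite /bform dE linearD linearB linearZ /= /GRing.scale /=; ring.
Qed.

Lemma bform_transl r s l : S l ->
  bform r s (psi (transl (hatx S) l)) = lam r l * lam s l.
Proof.
move=> Sl; have [_ dE] := translation_transl semS Sl.
by rewrite /bform dE linearN linearZ /= opprK mulrC.
Qed.

Lemma translation1 : translation (1%g : orth) 0.
Proof.
move=> a v f; rewrite /dualpart !act1 /=.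
by rewrite linear0 subr0 scaler0 !addr0.
Qed.

Lemma bform1 r s : bform r s 1%g = 0.
Proof. by rewrite /bform /dualpart act1 /= linear0 oppr0. Qed.

Lemma bform_gena r s i : r != s ->
  bform r s (psi (gena (hatx S) sigma i)) = 0.
Proof.
move=> rs; rewrite bform_transl ?lam_sigma //.
by case: eqVneq => [<-|]; rewrite ?mul0r // eq_sym (negPf rs) mulr0.
Qed.

Lemma translation_gena i : translation (psi (gena (hatx S) sigma i)) (sigma i).
Proof. by have [] := translation_transl semS (Ssigma i). Qed.

Lemma translation_prod (L : seq 'I_nu) :
  translation (psi (\prod_(j <- L) gena (hatx S) sigma j)%g)
    (\sum_(j <- L) sigma j).
Proof.
elim: L => [|j L IHL]; first by rewrite !big_nil psi1; exact: translation1.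
rewrite !big_cons psiM.
by have [] := translationM (translation_gena j) IHL.
Qed.

Lemma lam_tau_seq i (L : seq 'I_nu) : uniq L ->
  lam i (\sum_(j <- L) sigma j) = (i \in L)%:R.
Proof.
elim: L => [|j L IHL]; first by rewrite big_nil linear0.
move=> /= /andP[jL uL]; rewrite big_cons linearD /= IHL // lam_sigma inE.
by case: (eqVneq i j) => [->|_]; rewrite ?(negPf jL) ?addr0 ?add0r.
Qed.

Lemma lam_zspan_int l i : zspan (range sigma) l -> lam i l \is a Num.int.
Proof.
move: l; apply: smallest_sub.
  by split=> [|x y ix iy] /=; rewrite ?linear0 ?linearB // rpredB.
by move=> _ [j _ <-] /=; rewrite lam_sigma.
Qed.

Lemma lam_tau i J : lam i (tau sigma J) = (i \in J)%:R.
Proof. by rewrite /tau -big_enum lam_tau_seq ?enum_uniq // mem_enum. Qed.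

(** The coordinates of [tau sigma J] are the indicator of [J], so their parities determine [J]. *)
Lemma tau_class_inj (J K : {set 'I_nu}) l : zspan (range sigma) l ->
  tau sigma J = tau sigma K + l *+ 2 -> J = K.
Proof.
move=> Zl EJK; apply/finset.setP => i.
have /intrP[m lm] := lam_zspan_int i Zl.
have := congr1 (lam i) EJK; rewrite linearD linearMn /= !lam_tau lm.
rewrite !pmulrn -mulrzA -mulrzDr => /eqP.
rewrite eqr_int; case: (i \in J); case: (i \in K) => //= /eqP; clear; lia.
Qed.

(** By [bformM] a factor indexed by r contributes 2 with each later factor indexed by s; since
    indices increase along [L] and r < s, this happens once if both occur. *)
Lemma bform_prod (r s : 'I_nu) (L : seq 'I_nu) : (r < s)%N ->
  sorted ltn [seq val i | i <- L] ->
  bform r s (psi (\prod_(j <- L) gena (hatx S) sigma j)%g) =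
    2 * ((r \in L) && (s \in L))%:R.
Proof.
move=> lt_rs; have rs : r != s by rewrite -val_eqE ltn_eqF.
elim: L => [|j L IHL]; first by rewrite big_nil psi1 bform1 mulr0.
move=> sL; have uL : uniq (j :: L).
  by rewrite -(map_inj_uniq val_inj); apply: sorted_uniq sL;
    [exact: ltn_trans | exact: ltnn].
move: sL; rewrite /= (path_sortedE ltn_trans) => /andP[/allP jL sL].
rewrite big_cons psiM (bformM r s (translation_gena j) (translation_prod L)).
move: uL => /= /andP[jL' uL].
rewrite bform_gena // add0r IHL // lam_sigma lam_tau_seq // !inE -mulrDr.
congr (_ * _); case: (eqVneq r j) => [rj|_] /=.
  by rewrite rj (negPf jL') /= add0r mul1r -rj eq_sym (negPf rs).
rewrite mul0r addr0; case: (eqVneq s j) => [sj|//] /=.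
have /negPf-> : r \notin L.
  apply/negP => rL; have := jL r (map_f val rL).
  by rewrite -sj ltnNge /= ltnW.
by [].
Qed.

(** The reflection in alpha_1 negates alpha_1 and fixes V^0 and its dual, so an element commuting
    with it preserves the line of alpha_1 and sends functionals to vectors without alpha_1
    component. *)
Lemma weyl_center_translation g :
  group_center (weyl_group S) g -> translation g 0.
Proof.
move=> [Wg gC]; have S0 := semilattice0 semS.
have gC' s : S s -> forall u, act g (act (rfl s) u) = act (rfl s) (act g u).
  by move=> Ss u; rewrite -!actM gC //; exact: weyl_psi.
have gN u : act g (- u) = - act g u by exact: linearN.
have gD u v : act g (u + v) = act g u + act g v by exact: linearD.
have gZ k u : act g (k *: u) = k *: act g u by exact: linearZ.
have [p gp] : exists p, act g ((1, 0), 0) = ((p, 0), 0).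
  have := gC' 0 S0 ((1, 0), 0); rewrite act_rfl // scaler0 subr0 linear0 subr0.
  have -> : ((-1 : R^o, 0 : V0), 0 : 'Hom(V0, R^o)) = - ((1, 0), 0).
    by congr pair; [congr pair|]; rewrite /= oppr0.
  rewrite gN; have := weyl_dual semS Wg ((1, 0), 0).
  case: (act g _) => [[p q] h] /= ->; rewrite act_rfl // scaler0 subr0 => -[_
    qq].
  by exists p; rewrite (oppr_fixed qq).
have gv v : act g ((0, v), 0) = ((0, v), 0) by exact: (weyl_fix semS).
have gav c v : act g ((c, v), 0) = ((c * p, v), 0).
  have -> : ((c, v), 0) = c *: ((1, 0), 0) + ((0, v), 0) :> hyperspace V0.
    congr pair; [congr pair|]; rewrite /= ?scaler0 ?addr0 ?add0r //.
    by rewrite /GRing.scale /= mulr1.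
  rewrite gD gZ gp gv.
  by congr pair; [congr pair|]; rewrite /= ?scaler0 ?addr0 ?add0r.
(* Commutation with the reflection in alpha_1 + sigma_i, applied to that root, gives -1 = 1 - 2p on
   sigma_i. *)
have p1 : p = 1.
  pose i0 := Ordinal nu_gt0; have Si0 := Ssigma i0.
  have := gC' _ Si0 ((1, sigma i0), 0).
  rewrite gav !act_rfl // gav => -[_] /(congr1 (lam i0)).
  rewrite !linearB !linearZ /= !zero_lfunE lam_sigma eqxx /GRing.scale /=.
  lra.
have gf f : (act g ((0, 0), f)).1.1 = 0.
  have := gC' 0 S0 ((0, 0), f).
  rewrite act_rfl // (linear0 f) scaler0 !subr0 oppr0;
    case: (act g _) => [[a v] h]; rewrite act_rfl // (linear0 h) subr0.
  by move=> -[/= aa _]; exact: oppr_fixed.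
move=> a v f; rewrite linear0 subr0 scaler0 addr0.
have -> : ((a, v), f) = a *: ((1, 0), 0) + ((0, v), 0) + ((0, 0), f) :>
  hyperspace V0.
  congr pair; [congr pair|]; rewrite /= ?scaler0 ?addr0 ?add0r //.
  by rewrite /GRing.scale /= mulr1.
rewrite !gD gZ gp gv /dualpart; have := gf f;
  have := weyl_dual semS Wg ((0, 0), f).
case: (act g _) => [[b w] h] /= -> ->.
congr pair; [congr pair|]; rewrite /= ?scaler0 ?addr0 ?add0r //.
by rewrite /GRing.scale /= p1 mulr1.
Qed.

Lemma dualpart_linear (g : orth) k f h :
  dualpart g (k *: f + h) = k *: dualpart g f + dualpart g h.
Proof.
rewrite /dualpart.
have -> : ((0, 0), k *: f + h) = k *: ((0, 0), f) + ((0, 0), h) :> hyperspace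
  V0.
  by congr pair; congr pair; rewrite /= scaler0 addr0.
by rewrite act_linear.
Qed.

(** As g preserves the form and has no translation part, [dualpart g] is skew-symmetric; its entries
    with r < s determine it, and thereby g. *)
Lemma bform_inj g : group_center (weyl_group S) g ->
  (forall r s : 'I_nu, (r < s)%N -> bform r s g = 0) -> g = 1%g.
Proof.
move=> gC g0; have gT := weyl_center_translation gC.
have anti (f h : 'Hom(V0, R^o)) : f (dualpart g h) = - h (dualpart g f).
  have gE k : act g ((0, 0), k) = ((0, dualpart g k), k).
    by rewrite gT (linear0 k) subr0 scaler0 !add0r.
  have := act_form g ((0, 0), f) ((0, 0), h); rewrite !gE.
  rewrite /hyper_form /root_form /= !mul0r (linear0 f) (linear0 h) !add0r.
  by move=> /eqP; rewrite addrC addr_eq0 => /eqP.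
have d0 s : dualpart g (lam s) = 0.
  apply: lam_inj => r; have [rs|sr|/val_inj->] := ltngtP r s.
  - by apply: oppr_inj; rewrite oppr0; exact: g0.
  - by rewrite anti; exact: g0.
  - by apply: oppr_fixed; rewrite -anti.
have d0' f : dualpart g f = 0.
  have dD h k : dualpart g (h + k) = dualpart g h + dualpart g k.
    by have := dualpart_linear g 1 h k; rewrite !scale1r.
  have d00 : dualpart g 0 = 0.
    by apply: (addrI (dualpart g 0)); rewrite -dD !addr0.
  rewrite (hom_sum f) (big_morph (dualpart g) dD d00) big1 // => i _.
  by have := dualpart_linear g (f (sigma i)) (lam i) 0;
    rewrite !addr0 d0 d00 scaler0 addr0.
apply: act_inj => -[[a v] f].
by rewrite gT act1 linear0 subr0 scaler0 d0' !addr0.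
Qed.

Lemma lam_int s i : S s -> lam i s \is a Num.int.
Proof. by move=> /sigma_span; exact: lam_zspan_int. Qed.

Lemma hom_int (f : 'Hom(V0, R^o)) s : S s ->
  (forall i, f (sigma i) \is a Num.int) -> f s \is a Num.int.
Proof.
move=> Ss fint; rewrite (lam_sum s) linear_sum rpred_sum // => i _.
by rewrite linearZ /=; apply: rpredM; [exact: lam_int | exact: fint].
Qed.

(** Each reflection preserves the lattice of vectors with integer coordinates on alpha_1, the
    [sigma i] and the dual basis; up to sign, [bform] is a coordinate of the image of [lam s]. *)
Lemma bform_int r s g : weyl_group S g -> bform r s g \is a Num.int.
Proof.
move=> Wg; pose P (u : hyperspace V0) := [/\ (u.1.1 : R) \is a Num.int,
  forall i, lam i u.1.2 \is a Num.int & forall i, u.2 (sigma i) \is a Num.int].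
suff gP u : P u -> P (act g u).
  have [|_ + _] := gP ((0, 0), lam s).
    by split=> [|i|i] /=; rewrite ?linear0 ?lam_sigma.
  by rewrite /bform rpredN; exact.
move: g Wg u; apply: weyl_ind => // [u|t g St IHg u /IHg].
  by rewrite act1.
rewrite actM; case: (act g u) => [[a v] f] [/= ia iv iF].
have ift : f t \is a Num.int by exact: hom_int.
rewrite act_rfl //; split=> //= [|i]; first by rewrite rpredB ?rpredN.
rewrite linearB linearZ /=; apply: rpredB; first exact: iv.
apply: rpredM; last exact: lam_int.
by apply: rpredD => //; apply: rpredM => //; exact: rpred_nat.
Qed.

End WeylCoordinates.

(** * Integral collections and the kernel of psi *)

Section IntegralCollections.
Variables (nu : nat) (supp : {set {set 'I_nu}}).

Definition pair_count (e : {set 'I_nu} -> bool) (r s : 'I_nu) : nat :=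
  (\sum_(J in Esupp supp | (r \in J) && (s \in J)) e J)%N.

(** A pair contained in a set of at least three elements is a proper subset of it. *)
Lemma deltaJE J (r s : 'I_nu) : J \in Esupp supp -> r != s ->
  deltaJ J r s = ((r \in J) && (s \in J) : nat).
Proof.
rewrite inE => /andP[_ J3] rs; rewrite /deltaJ properEcard cards2 rs.
by rewrite (leq_trans _ J3) // andbT finset.subUset !finset.sub1set;
  case: (_ && _).
Qed.

Lemma delta_neq0 (r s : 'I_nu) : delta supp r s != 0.
Proof. by rewrite /delta; case: ifP. Qed.

(** Clears denominators. The integer n is minus the quotient: it will be the coefficient of y_rs
    that cancels the contribution of the z_J. *)
Lemma integral_collectionP (eps : collection supp) (e : {set 'I_nu} -> bool) :
  (forall u, eps u = e (val u) :> nat) ->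
  integral_collection eps <-> forall r s : 'I_nu, (r < s)%N ->
    exists n : int, (pair_count e r s)%:Z + (delta supp r s)%:Z * n = 0.
Proof.
move=> epsE.
have sumE (r s : 'I_nu) : (r < s)%N ->
    \sum_J (deltaJ (val J) r s)%:R * (eps J)%:R = (pair_count e r s)%:R :> rat.
  move=> lt_rs; have rs : r != s by rewrite -val_eqE ltn_eqF.
  rewrite /pair_count natr_sum.
  rewrite [RHS](big_sub_cond (mem (Esupp supp))) /= [RHS]big_mkcond /=.
  apply: eq_bigr => u _; rewrite deltaJE ?epsE //; last exact: (valP u).
  by case: (_ && _); rewrite ?mul1r ?mul0r.
have d0 r s : (delta supp r s)%:R != 0 :> rat by rewrite pnatr_eq0 delta_neq0.
split=> int_eps r s rs.
  have := int_eps r s rs; rewrite sumE // => /intrP[m Em]; exists (- m).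
  apply/eqP; rewrite mulrN subr_eq0 -(eqr_int rat) intrM -Em mulVKf //;
    exact: d0.
have [n En] := int_eps r s rs; rewrite sumE //; apply/intrP; exists (- n).
have /(congr1 (fun k : int => k%:~R : rat)) := En.
rewrite intrD intrM => /eqP; rewrite addr_eq0 -mulrN -mulrNz => /eqP.
by rewrite -[_%:~R]/(_%:R) => ->; rewrite mulKf.
Qed.

End IntegralCollections.

Section Kernel.
Variables (R : realType) (V0 : vectType R) (S : set V0) (nu : nat).
Variables (sigma : 'I_nu -> V0) (supp : {set {set 'I_nu}}).
Hypotheses (semS : semilattice S) (Ssigma : forall i, S (sigma i)).
Hypotheses (nu_gt0 : (0 < nu)%N) (dimV0 : \dim {:V0} = nu)
  (sigma_basisZ : zbasis (zspan S) sigma)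
  (suppS : supporting_class S sigma supp).

Local Notation orth := (orthogonal_group (@hyper_form R V0)).
Local Notation W := (weyl_group S).
Local Notation hat := (weyl_hat S).
Local Notation rfl s := (psi (hatx S s)).
Local Notation a_ := (gena (hatx S) sigma).
Local Notation z_ := (genz (hatx S) sigma).
Local Notation y_ := (geny (hatx S) sigma supp).
Local Notation tr := (transl (hatx S)).
Local Notation spany := (spany (hatx S) sigma supp).
Local Notation spanC := (spanC (hatx S) sigma supp).
Local Notation bf := (bform sigma).

Let S0 : S 0 := semilattice0 semS.
Let SD2 : forall s t, S s -> S t -> S (s + t *+ 2) := semilatticeD2 semS.
Let SB2 : forall s t, S s -> S t -> S (s - t *+ 2) := semilatticeB2 semS.
Let xx : forall s, S s -> (hatx S s * hatx S s = 1)%g.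
Proof. exact: hatx_involution. Qed.
Let xJ : forall s t, S s -> S t ->
  (hatx S s * hatx S t * hatx S s)%g = hatx S (s *+ 2 - t).
Proof. exact: hatxJ. Qed.
Let xgen : generated [set hatx S s | s in S] = setT.
Proof. exact: hatx_generated. Qed.

Let sigma_span s : S s -> zspan (range sigma) s.
Proof. by move=> Ss; rewrite sigma_basisZ.1; exact: sub_gen_smallest. Qed.

Let S_tau s : S s -> exists2 J, J \in supp &
  exists2 l, zspan (range sigma) l & s = tau sigma J + l *+ 2.
Proof.
rewrite {1}suppS.2 => -[J /= Jsupp [l Zl <-]]; exists J => //.
by exists l; rewrite // sigma_basisZ.1.
Qed.

Let Ssupp J : J \in supp -> S (tau sigma J).
Proof.
move=> Jsupp; rewrite suppS.2; exists J => //; exists 0.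
  by move=> A [[]].
by rewrite mul0rn addr0.
Qed.

Let supp1 i : [set i]%SET \in supp.
Proof.
have [J Jsupp [l Zl]] := S_tau (Ssigma i).
rewrite -[sigma i](_ : tau sigma [set i]%SET = _);
  last by rewrite /tau big_set1.
by move/(tau_class_inj semS dimV0 sigma_span Zl) => ->.
Qed.

Let xgen_tau :
  generated [set hatx S (tau sigma J) | J in [set` supp]] = setT.
Proof.
exact: (generated_tau S0 SD2 SB2 xx xJ xgen Ssigma Ssupp suppS.1 supp1 S_tau).
Qed.

(** * Coordinates of the central elements z_J and y_rs *)

Definition beta (r s : 'I_nu) (z : center hat) : R := bf r s (psi (cval z)).

Lemma psi_center (z : center hat) : group_center W (psi (cval z)).
Proof.
split=> [|_ /(psi_onto semS)[k <-]]; first exact: weyl_psi.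
by rewrite -!psiM center_commute.
Qed.

Lemma bf_centerM r s g h : group_center W g -> group_center W h ->
  bf r s (g * h)%g = bf r s g + bf r s h.
Proof.
move=> gC hC; have T := weyl_center_translation semS Ssigma nu_gt0 dimV0
  sigma_span.
by rewrite (bformM _ r s (T g gC) (T h hC)) linear0 mul0r mulr0 addr0.
Qed.

Fact beta_is_zmod_morphism r s : zmod_morphism (beta r s).
Proof.
move=> z w; apply/eqP; rewrite eq_sym subr_eq; apply/eqP.
by rewrite -[in LHS](subrK w z) {1}/beta cvalD psiM bf_centerM //;
  exact: psi_center.
Qed.

HB.instance Definition _ r s :=
  GRing.isZmodMorphism.Build (center hat) R (beta r s)
    (beta_is_zmod_morphism r s).

Lemma psi_center_eq1 (z : center hat) :
  psi (cval z) = 1%g <-> forall r s : 'I_nu, (r < s)%N -> beta r s z = 0.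
Proof.
split=> [z1 r s _|z0]; first by rewrite /beta z1 bform1.
by apply: (bform_inj semS Ssigma nu_gt0 dimV0 sigma_span) => //;
  exact: psi_center.
Qed.

(** Compare coordinates in [genzE]: when r and s lie in [J], the product has 2 and
    [transl (tau sigma J)] has 1; otherwise both have 0. *)
Lemma beta_genz (r s : 'I_nu) J : (r < s)%N -> J \in supp ->
  beta r s (z_ J) = ((r \in J) && (s \in J))%:R.
Proof.
move=> rs Jsupp; have SJ := Ssupp Jsupp.
have := congr1 (fun g => bf r s (psi g))
  (genzE S0 SD2 SB2 xx xJ xgen Ssigma Ssupp Jsupp).
have T := weyl_center_translation semS Ssigma nu_gt0 dimV0 sigma_span.
rewrite psiM (bformM _ r s (T _ (psi_center _)) (translation_transl semS SJ).1).
rewrite linear0 mul0r mulr0 addr0 -/(beta r s _) bform_transl //.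
rewrite !(lam_tau semS dimV0 sigma_span) /genP.
rewrite (bform_prod semS Ssigma dimV0 sigma_span rs); last first.
  rewrite /enum_mem; apply: (subseq_sorted ltn_trans) (iota_ltn_sorted 0 nu).
  by rewrite -val_enum_ord map_subseq // enumT filter_subseq.
rewrite !mem_enum; move: (beta r s _) => b.
by case: (r \in J); case: (s \in J) => /=; lra.
Qed.

(** At (r, s) = (p, q) the product a_p a_q has coordinate 2. If {p, q} is in [supp], the translation
    by sigma_p + sigma_q takes away 1; otherwise a_q a_p takes away 0. *)
Lemma beta_geny (r s p q : 'I_nu) : (r < s)%N -> (p < q)%N ->
  beta r s (y_ p q) = (delta supp p q)%:R * ((r == p) && (s == q))%:R.
Proof.
move=> rs pq; have rs' : r != s by rewrite -val_eqE ltn_eqF.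
have pq' : p != q by rewrite -val_eqE ltn_eqF.
have lamE := lam_sigma semS dimV0 sigma_span.
have T := weyl_center_translation semS Ssigma nu_gt0 dimV0 sigma_span.
have Ta i := translation_gena semS Ssigma i.
have ba := bform_gena semS Ssigma dimV0 sigma_span.
have aa u v : bf r s (psi (a_ u * a_ v)%g) = 2 * ((r == u) && (s == v))%:R.
  rewrite psiM (bformM _ r s (Ta u) (Ta v)) !ba // !addr0 add0r.
  by rewrite !lamE -natrM mulnb.
have qp0 : (r == q) && (s == p) = false.
  apply/negP => /andP[/eqP rq /eqP sp].
  by move: rs; rewrite rq sp ltnNge (ltnW pq).
have both i : (i == p) && (i == q) = false.
  by apply/negP => /andP[/eqP-> /idPn]; rewrite pq'.
have other i : (r == i) && (s == i) = false.
  by apply/negP => /andP[/eqP<- /idPn]; rewrite eq_sym rs'.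
rewrite /delta; case: ifP => [pq_supp|pq_supp].
  have := congr1 (fun g => bf r s (psi g))
    (genyE S0 SD2 SB2 xx xJ xgen Ssigma Ssupp pq_supp pq').
  rewrite aa psiM; have := Ssupp pq_supp; rewrite tau2 // => Spq.
  rewrite (bformM _ r s (T _ (psi_center _)) (translation_transl semS Spq).1).
  rewrite linear0 mul0r mulr0 addr0 -/(beta r s _) bform_transl //.
  rewrite !linearD /= !lamE mul1r; move: (beta r s _) => b.
  move: qp0 (both r) (both s) (other p) (other q).
  by case: (r == p); case: (s == p); case: (r == q); case: (s == q) => //=; lra.
rewrite /geny pq_supp.
have := congr1 (fun g => bf r s (psi g))
  (gencE S0 SD2 SB2 xx xJ xgen Ssigma p q).
rewrite aa psiM.
have [Tqp _] := translationM (Ta q) (Ta p); rewrite -psiM in Tqp.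
rewrite (bformM _ r s (T _ (psi_center _)) Tqp) aa qp0 linear0 mul0r !mulr0
  !addr0.
by move=> ->.
Qed.

Lemma beta_spanC (r s : 'I_nu) (eps : {set 'I_nu} -> bool)
    (n : 'I_nu -> 'I_nu -> int) : (r < s)%N ->
  beta r s (\sum_(J in Esupp supp) z_ J *+ eps J +
            \sum_(p < nu) \sum_(q < nu | (p < q)%N) y_ p q *~ n p q) =
  ((pair_count supp eps r s)%:Z
    + (delta supp r s)%:Z * n r s)%:~R.
Proof.
move=> rs; rewrite raddfD raddf_sum raddf_sum /= [RHS]intrD; congr (_ + _).
  rewrite -[RHS]/(_%:R) natr_sum [RHS]big_mkcondr /=; apply: eq_bigr => J JE.
  rewrite raddfMn /= beta_genz ?(Esupp_supp JE) //.
  by case: (_ && _); case: (eps J).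
rewrite (bigD1 r) //= [X in _ + X]big1 ?addr0 => [|p pr].
  rewrite raddf_sum (bigD1 s) //= [X in _ + X]big1 ?addr0 => [|q /andP[rq qs]].
    by rewrite raddfMz /= beta_geny // !eqxx mulr1 intrM mulrzr.
  by rewrite raddfMz /= beta_geny // [s == q]eq_sym (negPf qs) andbF mulr0
    mul0rz.
rewrite raddf_sum big1 // => q pq.
by rewrite raddfMz /= beta_geny // [r == p]eq_sym (negPf pr) mulr0 mul0rz.
Qed.

(** * Reduction of the kernel to [spanC] *)

Definition shift (g : orth) l := forall a v,
  act g ((a, v), 0) = ((a, v + (a * 2) *: l), 0).

Lemma shift_translation g l : translation g l -> shift g l.
Proof.
move=> gl a v; rewrite gl zero_lfunE subr0; congr (_, _, _).
suff -> : dualpart g 0 = 0 by rewrite addr0.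
by rewrite /dualpart; have /= -> : act g 0 = 0 by exact: linear0.
Qed.

Lemma shiftM g h l m : shift g l -> shift h m -> shift (g * h)%g (l + m).
Proof.
by move=> gl hm a v; rewrite actM hm gl scalerDr [in RHS]addrA addrAC.
Qed.

Lemma shift1 : shift 1%g 0.
Proof. by move=> a v; rewrite act1 scaler0 addr0. Qed.

Lemma shiftV g l : shift g l -> shift g^-1%g (- l).
Proof.
move=> gl a v; have /(congr1 (act g^-1%g)) := gl a (v - (a * 2) *: l).
by rewrite subrK -actM mulVg act1 scalerN => <-.
Qed.

Lemma shift_zexpg g l n : shift g l -> shift (zexpg g n) (l *~ n).
Proof.
move=> gl; have gX m : shift (g ^+ m)%g (l *+ m).
  elim: m => [|m IHm]; first exact: shift1.
  by rewrite mulrS expgS; exact: shiftM.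
case: n => n; first exact: gX.
by rewrite NegzE mulrNz /=; exact/shiftV/gX.
Qed.

(** In the image of alpha_1 under a normal form, the sign of alpha_1 shows the parity of the power
    of x_0 and the V^0 component shows the exponents. On the kernel all are trivial, and only the
    factor in [spanC] remains. *)
Lemma psi_ker k : psi k = 1%g -> exists2 c, spanC c & k = cval c.
Proof.
move=> k1; have [l [e [c Cc Ek]]] :=
  normal_form S0 SD2 SB2 xx xJ xgen Ssigma Ssupp xgen_tau k.
have sT : shift (psi (genT (hatx S) sigma (enum 'I_nu) l))
    (\sum_i sigma i *~ l i).
  rewrite /genT -big_enum; elim: (enum 'I_nu) => [|i L IHL].
    by rewrite !big_nil psi1; exact: shift1.
  rewrite !big_cons psiM; apply: shiftM IHL.
  rewrite morph_zexpg; last exact: psiM.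
  by apply: shift_zexpg; apply: shift_translation; exact: translation_gena.
have sc : shift (psi (cval c)) 0.
  apply: shift_translation.
  exact: (weyl_center_translation semS Ssigma nu_gt0 dimV0 sigma_span)
    (psi_center c).
have := congr1 (fun g => act g ((1, 0), 0)) k1; rewrite Ek !psiM act1 actM actM.
case: e Ek => Ek.
  rewrite expg1 act_rfl // sT sc !zero_lfunE => -[/= /eqP].
  rewrite subr0 eq_sym -subr_eq0 opprK -[1 + 1]/(2%:R) pnatr_eq0; done.
rewrite expg0 psi1 act1 sT sc scaler0 addr0 add0r mul1r => -[].
move=> /eqP; rewrite scaler_eq0 pnatr_eq0 => /eqP /sigma_basisZ.2 l0.
by exists c => //; rewrite mulg1 genT0 ?mulg1.
Qed.

(** * Characters of the presented group with values in Z/2 *)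

Definition chi_root (J : {set 'I_nu}) (a : nonisotropic_roots S) : 'I_2 :=
  if `[< exists2 l, zspan (range sigma) l &
         (val a).2 = tau sigma J + l *+ 2 >] then 1 else 0.

Definition chi J : hat -> 'I_2 := presented_lift (chi_root J).

Let zspanB x y : zspan (range sigma) x -> zspan (range sigma) y ->
  zspan (range sigma) (x - y).
Proof. by move=> Zx Zy A sA; apply: sA.1.2; [exact: Zx | exact: Zy]. Qed.

Let zspan0 : zspan (range sigma) 0.
Proof. by move=> A [[]]. Qed.

(** A reflection changes the V^0 component of a root by an element of 2 Lambda. *)
Lemma chi_rootJ J (a b c : nonisotropic_roots S) :
  val c = root_reflection (val a) (val b) -> chi_root J c = chi_root J b.
Proof.
have root2 (d : nonisotropic_roots S) :
    zspan (range sigma) (val d).2 /\ ((val d).1 = 1 \/ (val d).1 = -1).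
  have [s /sigma_span Zs] : nonisotropic_roots S (val d) by exact/set_mem/valP.
  by rewrite alpha1D alpha1N => -[->|->]; split=> //; [left | right].
move=> abc; have [Za a1] := root2 a; have [_ b1] := root2 b.
have [m Zm Ec] : exists2 m, zspan (range sigma) m &
    (val c).2 = (val b).2 + m *+ 2.
  have ZNa : zspan (range sigma) (- (val a).2) by rewrite -sub0r; exact: zspanB.
  rewrite abc /root_reflection /root_form /=.
  case: a1 => ->; case: b1 => ->; rewrite ?mulrNN ?mulrN ?mulNr ?mulr1 ?mul1r.
  - by exists (- (val a).2) => //; rewrite mulNrn scaler_nat.
  - by exists (val a).2 => //; rewrite scaleNr opprK scaler_nat.
  - by exists (val a).2 => //; rewrite scaleNr opprK scaler_nat.
  - by exists (- (val a).2) => //; rewrite mulNrn scaler_nat.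
rewrite /chi_root; congr (if _ then _ else _); apply: asbool_equiv_eq.
split=> -[l Zl El].
  exists (l - m); first exact: zspanB.
  by rewrite mulrnBl addrA -El Ec addrK.
exists (l + m); last by rewrite mulrnDl addrA -El.
by rewrite -[m]opprK; apply: zspanB => //; rewrite -sub0r; exact: zspanB.
Qed.

Lemma chi_relators J r :
  conjugation_relators r -> eval_word (chi_root J) r = 1%g.
Proof.
have I2D (u : 'I_2) : u + u = 0 by case: u => [[|[]]] // lt_u; exact: val_inj.
have I2N (u : 'I_2) : - u = u by case: u => [[|[]]] // lt_u; exact: val_inj.
case=> [[a _ <-]|[a [b [c [abc ->]]]]]; rewrite /eval_word !big_cons big_nil /=.
  rewrite mulg1; exact: I2D.
rewrite (chi_rootJ J abc) mulg1.
change (chi_root J a + (chi_root J b + (chi_root J a - chi_root J b)) = 0).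
by rewrite addrCA (addrA (chi_root J a)) I2D add0r I2N I2D.
Qed.

Lemma chiM J g h : chi J (g * h)%g = chi J g + chi J h.
Proof. exact: (presented_liftM (@chi_relators J)). Qed.

Lemma chi_hatx J s : S s -> chi J (hatx S s) =
  if `[< exists2 l, zspan (range sigma) l & s = tau sigma J + l *+ 2 >]
  then 1 else 0.
Proof. by move=> Ss; rewrite (hatxE Ss) /chi (presented_lift_gen (@chi_relators
  J)). Qed.

Lemma chi_tau J K : K \in supp ->
  chi J (hatx S (tau sigma K)) = if K == J then 1 else 0.
Proof.
move=> Ksupp; rewrite chi_hatx; last exact: Ssupp.
congr (if _ then _ else _); apply/asboolP/eqP => [[l Zl]|->].
  exact: (tau_class_inj semS dimV0 sigma_span Zl).
by exists 0; rewrite ?mul0rn ?addr0.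
Qed.

Lemma chi1 J : chi J 1%g = 0.
Proof. by apply: (addrI (chi J 1%g)); rewrite -chiM mul1g addr0. Qed.

Lemma chi_transl J K : J \in Esupp supp -> K \in supp ->
  chi J (tr (tau sigma K)) = if K == J then 1 else 0.
Proof.
move=> JE Ksupp; rewrite /transl chiM chi_tau //.
have := chi_tau J suppS.1; rewrite {1}/tau big_set0 => ->.
rewrite [X in _ + X]ifN ?addr0 //; apply/eqP => J0.
by move: JE; rewrite -J0 inE cards0 andbF.
Qed.

Lemma chi_gena J i : J \in Esupp supp -> chi J (a_ i) = 0.
Proof.
move=> JE; rewrite /gena -[sigma i](_ : tau sigma [set i]%SET = _).
  rewrite chi_transl // ifN //; apply/eqP => Ji.
  by move: JE; rewrite -Ji inE cards1 andbF.
by rewrite /tau big_set1.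
Qed.

(** The character kills every [gena i], singletons not being in [Esupp]; so on z_K it is minus its
    value on the translation by tau_K, and signs do not matter modulo 2. *)
Lemma chi_genz J K : J \in Esupp supp -> K \in supp ->
  chi J (cval (z_ K)) = if K == J then 1 else 0.
Proof.
move=> JE Ksupp; have := congr1 (chi J)
  (genzE S0 SD2 SB2 xx xJ xgen Ssigma Ssupp Ksupp).
rewrite chiM chi_transl // /genP.
have -> : chi J (\prod_(j <- enum K) a_ j)%g = 0.
  elim: (enum K) => [|i L IHL]; first by rewrite big_nil chi1.
  by rewrite big_cons chiM IHL chi_gena // addr0.
by case: ifP => _; rewrite ?addr0 // => /(congr1 (fun u => u + 1));
  rewrite add0r -addrA => <-; rewrite (_ : 1 + 1 = 0) ?addr0 //; exact: val_inj.
Qed.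

Lemma chi_geny J (r s : 'I_nu) : J \in Esupp supp -> (r < s)%N ->
  chi J (cval (y_ r s)) = 0.
Proof.
move=> JE rs; have rs' : r != s by rewrite -val_eqE ltn_eqF.
have [rs_supp|rs_supp] := boolP ([set r; s]%SET \in supp).
  have := congr1 (chi J)
    (genyE S0 SD2 SB2 xx xJ xgen Ssigma Ssupp rs_supp rs').
  rewrite chiM (chiM J (a_ r)) !chi_gena // -(tau2 _ rs') chi_transl // ifN
    ?addr0 //.
  by apply/eqP => Jrs; move: JE; rewrite -Jrs inE cards2 rs' andbF.
rewrite /geny (negPf rs_supp).
have := congr1 (chi J) (gencE S0 SD2 SB2 xx xJ xgen Ssigma r s).
by rewrite (chiM J (a_ r)) (chiM J (cval _)) (chiM J (a_ s)) !chi_gena //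
  !addr0.
Qed.

Lemma chi_sum J I (r : seq I) (P : pred I) (F : I -> center hat) :
  chi J (cval (\sum_(i <- r | P i) F i)) =
  \sum_(i <- r | P i) chi J (cval (F i)).
Proof.
apply: (big_morph (fun z => chi J (cval z))) => [u v|]; first exact: chiM.
exact: chi1.
Qed.

Lemma chiMz J (w : center hat) n : chi J (cval w) = 0 -> chi J (cval (w *~ n))
  = 0.
Proof.
move=> w0; have wn m : chi J (cval (w *+ m)) = 0.
  by elim: m => [|m IHm]; rewrite ?chi1 // mulrS cvalD chiM w0 add0r.
case: n => n; first exact: wn.
apply: (addrI (chi J (cval (w *+ n.+1)))).
by rewrite -chiM -cvalD NegzE mulrNz subrr chi1 wn addr0.
Qed.

Lemma chi_spanC J (eps : {set 'I_nu} -> bool) v : J \in Esupp supp -> spany v ->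
  chi J (cval (\sum_(K in Esupp supp) z_ K *+ eps K + v)) = if eps J then 1
    else 0.
Proof.
move=> JE [n ->]; rewrite cvalD chiM !chi_sum.
rewrite [X in _ + X]big1 ?addr0 => [|p _]; last first.
  rewrite chi_sum big1 // => q pq; apply: chiMz; exact: chi_geny.
rewrite (bigD1 J) //= [X in _ + X]big1 ?addr0 => [|K /andP[KE KJ]].
  case: (eps J); last by rewrite mulr0n chi1.
  by rewrite mulr1n chi_genz ?(Esupp_supp JE) // eqxx.
case: (eps K); last by rewrite mulr0n chi1.
by rewrite mulr1n chi_genz ?(Esupp_supp KE) // (negPf KJ).
Qed.

Let supp2 (r s : 'I_nu) J : J \in Esupp supp -> [set r; s]%SET != J.
Proof.
move=> JE; apply/eqP => Jrs; move: JE; rewrite -Jrs inE cards2.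
by case: (r != s); rewrite andbF.
Qed.

(** * Kernel elements and integral collections *)

Lemma psi_ker_spanC (e : {set 'I_nu} -> bool) v : spany v ->
  psi (cval (\sum_(J in Esupp supp) z_ J *+ e J + v)) = 1%g ->
  forall r s : 'I_nu, (r < s)%N ->
    exists n : int, (pair_count supp e r s)%:Z + (delta supp r s)%:Z * n = 0.
Proof.
move=> [n ->] /psi_center_eq1 b0 r s rs; exists (n r s).
by apply/eqP; rewrite -(intr_eq0 R) -beta_spanC //; apply/eqP; exact: b0.
Qed.

(** The coordinate (r, s) of a combination of the y_rs is its coefficient times delta(r, s), and
    delta(r, s) is nonzero. *)
Lemma psi_ker_spany v : spany v -> psi (cval v) = 1%g -> v = 0.
Proof.
move=> [n Ev] /psi_center_eq1 b0; rewrite Ev big1 // => r _;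
  rewrite big1 // => s rs.
have := b0 r s rs; have -> : v = \sum_(J in Esupp supp) z_ J *+ xpred0 J +
            \sum_(p < nu) \sum_(q < nu | (p < q)%N) y_ p q *~ n p q.
  by rewrite [X in X + _]big1 ?add0r.
rewrite beta_spanC // /pair_count big1 // add0r => /eqP.
rewrite intr_eq0 mulf_eq0 eqz_nat (negPf (delta_neq0 _ _ _)) => /eqP->.
by rewrite mulr0z.
Qed.

(** The integers solving the integrality equations, taken as coefficients of the y_rs, make all
    coordinates of the image vanish. *)
Lemma integral_kernel (e : {set 'I_nu} -> bool) :
  (forall r s : 'I_nu, (r < s)%N ->
    exists n : int, (pair_count supp e r s)%:Z + (delta supp r s)%:Z * n = 0) ->
  exists2 v, spany v &
    psi (cval (\sum_(J in Esupp supp) z_ J *+ e J + v)) = 1%g.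
Proof.
move=> e_int.
have /choice[n nP] : forall r : 'I_nu, exists n : 'I_nu -> int,
    forall s : 'I_nu, (r < s)%N ->
    (pair_count supp e r s)%:Z + (delta supp r s)%:Z * n s = 0.
  move=> r; suff /choice[n nP] : forall s : 'I_nu, exists n : int,
      (r < s)%N -> (pair_count supp e r s)%:Z + (delta supp r s)%:Z * n = 0.
    by exists n.
  move=> s; have [/e_int[n En]|] := boolP (r < s)%N; first by exists n.
  by exists 0.
eexists; first by exists n; reflexivity.
by apply/psi_center_eq1 => r s rs; rewrite beta_spanC // nP.
Qed.

(** * Injectivity of [psi], freeness of the center and integral collections *)

Definition psi_injective := forall k : hat, psi k = 1%g -> k = 1%g.

Definition only_trivial := forall eps : collection supp,
  integral_collection eps <-> eps =1 @trivial_collection nu supp.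

Lemma psi_injective_iso : psi_injective -> is_group_iso [set: hat] W (@psi R V0
  S).
Proof.
move=> inj; split; first by move=> x y _ _; exact: psiM.
split=> [k _|x y _ _ xy|g Wg]; first exact: weyl_psi.
  by apply: divg1_eq; apply: inj; rewrite psiM psiV xy mulgV.
by have [k kg] := psi_onto semS Wg; exists k.
Qed.

Lemma iso_psi_injective : is_group_iso [set: hat] W (@psi R V0 S) ->
  psi_injective.
Proof.
move=> [_ [_ inj _]] k k1; apply: inj; rewrite ?inE //.
by rewrite k1 psi1.
Qed.

(** The double of a kernel element lies in [spany], where [psi] is injective; so the element has
    order at most 2 and freeness kills it. *)
Lemma free_psi_injective :
  free_abelian (group_center [set: hat]) -> psi_injective.
Proof.
move=> /free_center_torsion tf k k1; have [c Cc Ek] := psi_ker k1.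
suff c0 : c = 0 by rewrite Ek c0.
rewrite Ek in k1; have c2 : psi (cval (c + c)) = 1%g by rewrite cvalD psiM k1
  mulg1.
apply: tf; apply: psi_ker_spany => //.
have [e [v Yv Ec]] := Cc; rewrite Ec addrACA -big_split /=.
apply: spanyD; last exact: spanyD.
apply: spany_sum => J /Esupp_supp Jsupp; rewrite -mulrnDl.
case: (e J); last exact: spany0.
exact: (spany_genz_double S0 SD2 SB2 xx xJ xgen Ssigma Ssupp).
Qed.

Lemma psi_injective_trivial : psi_injective -> only_trivial.
Proof.
move=> inj eps; split=> [int_eps u|eps0].
  (* The collection is extended by false outside [Esupp]; the characters then recover its values
     from a trivial element. *)
  pose e J := if insub J is Some u then eps u != ord0 else false.
  have eE w : eps w = e (val w) :> nat.
    by rewrite /e valK; case: (eps w) => -[|[]].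
  have [v Yv /inj c1] := integral_kernel ((integral_collectionP eE).1 int_eps).
  move: (eE u) (chi_spanC e (valP u) Yv); rewrite c1 chi1.
  by case: (e _) => // eps_u _; exact: val_inj.
apply/(@integral_collectionP _ _ eps xpred0) => [u|r s rs];
  first by rewrite eps0.
by exists 0; rewrite mulr0 addr0 /pair_count big1.
Qed.

Lemma trivial_psi_injective : only_trivial -> psi_injective.
Proof.
move=> triv k k1; have [c [e [v Yv Ec]] Ek] := psi_ker k1.
rewrite Ek Ec in k1 *.
pose eps : collection supp := fun u => if e (val u) then 1 else 0.
have epsE u : eps u = e (val u) :> nat by rewrite /eps; case: (e _).
have eps0 : eps =1 @trivial_collection nu supp.
  by apply/triv/(integral_collectionP epsE); exact: psi_ker_spanC k1.
have e0 : \sum_(J in Esupp supp) z_ J *+ e J = 0.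
  rewrite big1 // => J JE; have := eps0 (exist _ J JE).
  by rewrite /eps /=; case: (e J).
by rewrite e0 add0r in k1 *; rewrite (psi_ker_spany Yv k1).
Qed.

(** * Minimality of the reflections in Pi *)

Lemma Pi_reflectionsE : Pi_reflections S sigma supp =
  [set rfl (tau sigma J) | J in [set` supp]].
Proof.
apply/seteqP; split=> g.
  move=> [a [J /= Jsupp Ea] <-]; exists J => //.
  rewrite (hatxE (Ssupp Jsupp)) psi_gen; congr reflection.
  by apply: val_inj; rewrite /= -Ea alpha1D.
move=> [J /= Jsupp <-]; exists (root (Ssupp Jsupp)).
  by exists J => //=; rewrite alpha1D.
by rewrite (hatxE (Ssupp Jsupp)) psi_gen.
Qed.

Lemma weyl_subgroup : subgroup W.
Proof. exact: generated_subgroup. Qed.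

Lemma generated_Pi : generated (Pi_reflections S sigma supp) = W.
Proof.
rewrite Pi_reflectionsE; apply/seteqP; split.
  apply: generated_min; first exact: weyl_subgroup.
  by move=> _ [J _ <-]; exact: weyl_psi.
move=> _ /(psi_onto semS)[k <-]; set X := [set rfl _ | _ in _].
suff : generated [set hatx S (tau sigma J) | J in [set` supp]] `<=`
    [set k | generated X (psi k)] by apply; rewrite xgen_tau.
apply: generated_min; first exact/psi_preim_subgroup/generated_subgroup.
by move=> _ [J Jsupp <-]; apply: sub_generated; exists J.
Qed.

Lemma psi_injective_minimal : psi_injective ->
  minimal_generators W (Pi_reflections S sigma supp).
Proof.
move=> inj; split=> [|Y [YPi PiY] genY]; first exact: generated_Pi.
move: YPi PiY; rewrite Pi_reflectionsE => YPi PiY; apply: PiY.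
move=> _ [J /= Jsupp <-]; apply: contrapT => YJ.
(* [X] is the image of the kernel of [chi J]. It contains all reflections of Pi but that of [J],
   which injectivity of [psi] keeps out. *)
pose X := [set g | exists2 k, psi k = g & chi J k = 0].
have sX : subgroup X.
  split=> [|_ _ [k <- k0] [h <- h0]]; first by exists 1%g; rewrite ?psi1 ?chi1.
  exists (k * h^-1)%g; first by rewrite psiM psiV.
  rewrite chiM k0 add0r; apply: (addrI (chi J h)).
  by rewrite -chiM mulgV chi1 h0 addr0.
have YX : Y `<=` X.
  move=> g Yg; have [K /= Ksupp Eg] := YPi g Yg.
  exists (hatx S (tau sigma K)) => //; rewrite chi_tau // ifN //.
  by apply/eqP => KJ; apply: YJ; rewrite -KJ Eg.
have [k Ek k0] : X (rfl (tau sigma J)).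
  by apply: (generated_min sX YX); rewrite genY; exact: weyl_psi.
have := chi_tau J Jsupp; rewrite eqxx.
have <- : k = hatx S (tau sigma J).
  by apply: divg1_eq; apply: inj; rewrite psiM psiV Ek mulgV.
by rewrite k0.
Qed.

Lemma minimal_trivial :
  minimal_generators W (Pi_reflections S sigma supp) -> only_trivial.
Proof.
move=> [_ minPi] eps; split=> [int_eps|eps0]; last first.
  apply/(@integral_collectionP _ _ eps xpred0) => [u|r s rs];
    first by rewrite eps0.
  by exists 0; rewrite mulr0 addr0 /pair_count big1.
apply: contrapT => /existsNP[u eps_u].
pose e J := if insub J is Some u then eps u != ord0 else false.
have eE w : eps w = e (val w) :> nat.
  by rewrite /e valK; case: (eps w) => -[|[]].
pose J0 := val u; have J0E : J0 \in Esupp supp := valP u.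
have J0supp := Esupp_supp J0E.
have eJ0 : e J0.
  by rewrite /e valK; apply/eqP.
pose Y := [set rfl (tau sigma J) | J in [set J | J \in supp /\ J != J0]].
have [v Yv psi1c] := integral_kernel ((integral_collectionP eE).1 int_eps).
(* It suffices to put x_(tau_J0) in [K], the preimage of what the other reflections of Pi generate.
   As |J0| >= 3, x_0, the a_i and the y_rs are obtained without it. *)
pose K := [set k : hat | generated Y (psi k)].
have sK : subgroup K by exact/psi_preim_subgroup/generated_subgroup.
have Kx J : J \in supp -> J != J0 -> K (hatx S (tau sigma J)).
  by move=> Jsupp JJ0; apply: sub_generated; exists J.
have card_lt (J : {set 'I_nu}) : (#|J| < 3)%N -> J != J0.
  by move=> J2; apply/eqP => EJ; move: J0E; rewrite -EJ inE leqNgt J2 andbF.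
have Kx0 : K (hatx S 0).
  have := Kx _ suppS.1; rewrite /tau big_set0; apply.
  by apply: card_lt; rewrite cards0.
have Kt J : J \in supp -> J != J0 -> K (tr (tau sigma J)).
  by move=> Jsupp JJ0; apply: (subgroupM sK) => //; exact: Kx.
have Ka i : K (a_ i).
  have := Kt _ (supp1 i); rewrite /tau big_set1; apply.
  by apply: card_lt; rewrite cards1.
have KP J : K (genP (hatx S) sigma J) by apply: (subgroup_prod sK).
have Kz J : J \in supp -> J != J0 -> K (cval (z_ J)).
  move=> Jsupp JJ0.
  have <- : (genP (hatx S) sigma J * (tr (tau sigma J))^-1)%g = cval (z_ J).
    by rewrite -(genzE S0 SD2 SB2 xx xJ xgen Ssigma Ssupp Jsupp) mulgK.
  by apply: sK.2 => //; exact: Kt.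
have Ky (r s : 'I_nu) : (r < s)%N -> K (cval (y_ r s)).
  move=> rs; have rs' : r != s by rewrite -val_eqE ltn_eqF.
  have [rs_supp|rs_supp] := boolP ([set r; s]%SET \in supp).
    have <- : (a_ r * a_ s * (tr (sigma r + sigma s))^-1)%g = cval (y_ r s).
      by rewrite -(genyE S0 SD2 SB2 xx xJ xgen Ssigma Ssupp rs_supp rs') mulgK.
    apply: sK.2; first exact: (subgroupM sK).
    by rewrite -(tau2 _ rs'); apply: Kt => //; exact: supp2.
  rewrite /geny (negPf rs_supp).
  have <- : (a_ r * a_ s * (a_ s * a_ r)^-1)%g = cval (genc (hatx S) sigma r s).
    by rewrite (gencE S0 SD2 SB2 xx xJ xgen Ssigma) mulgK.
  by apply: sK.2; exact: (subgroupM sK).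
have KMz w n : K (cval w) -> K (cval (w *~ n)).
  by rewrite cvalMz; exact: subgroup_zexpg.
have Ksum I (r : seq I) (P : pred I) (F : I -> center hat) :
    (forall i, P i -> K (cval (F i))) -> K (cval (\sum_(i <- r | P i) F i)).
  move=> KF; apply: (big_ind (fun w => K (cval w))) => //; first exact: sK.1.
  by move=> x y Kx' Ky'; rewrite cvalD; exact: (subgroupM sK).
have Kv : K (cval v).
  have [n ->] := Yv; apply: (Ksum _ _ _ _) => r _;
    apply: (Ksum _ _ _ _) => s rs.
  by apply: KMz; exact: Ky.
(* The kernel element [c] has coefficient 1 at [J0] and all its other terms are in [K], so it can be
   solved for z_J0. *)
have Kz0 : K (cval (z_ J0)).
  set c := _ + v in psi1c.
  have -> : z_ J0 = c - (\sum_(J in Esupp supp | J != J0) z_ J *+ e J + v).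
    by rewrite /c (bigD1 J0) //= eJ0 mulr1n opprD addrA addrAC addrK addrK.
  rewrite cvalD cvalN; apply: sK.2; first by rewrite /K /= psi1c;
    exact: (generated_subgroup _).1.
  rewrite cvalD; apply: (subgroupM sK) => //; apply: Ksum => J /andP[JE JJ0].
  by case: (e J); [exact: Kz (Esupp_supp JE) JJ0 | exact: sK.1].
have Kx' : K (hatx S (tau sigma J0)).
  have -> : hatx S (tau sigma J0) = (tr (tau sigma J0) * hatx S 0)%g.
    by rewrite /transl -mulgA xx // mulg1.
  apply: (subgroupM sK) => //.
  have := genzE S0 SD2 SB2 xx xJ xgen Ssigma Ssupp J0supp.
  move=> /(congr1 (fun g => (cval (z_ J0))^-1 * g)%g); rewrite mulKg => ->.
  by apply: (subgroupM sK) => //; exact: (subgroupV sK).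
have YPi : Y `<=` Pi_reflections S sigma supp.
  by rewrite Pi_reflectionsE => _ [J [Jsupp _] <-]; exists J.
apply: (minPi Y).
  split=> // PiY; have : Y (rfl (tau sigma J0)).
    by apply: PiY; rewrite Pi_reflectionsE; exists J0.
  move=> [J [Jsupp /eqP JJ0]] /(rfl_inj (Ssupp Jsupp) (Ssupp J0supp)) EJ.
  apply: JJ0; apply: (tau_class_inj semS dimV0 sigma_span zspan0).
  by rewrite mul0rn addr0.
rewrite -generated_Pi; apply/seteqP; split.
  apply: generated_min; first exact: generated_subgroup.
  by move=> g /YPi; exact: sub_generated.
apply: generated_min; first exact: generated_subgroup.
rewrite Pi_reflectionsE => _ [J /= Jsupp <-].
by have [->|JJ0] := eqVneq J J0; [exact: Kx' | exact: Kx].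
Qed.

(** * Comparison of the centers *)

Lemma isog_center : group_isog [set: hat] W ->
  group_isog (group_center [set: hat]) (group_center W).
Proof.
move=> [f [fM [fW finj fsurj]]]; exists f.
have fM' x y : f (x * y)%g = (f x * f y)%g by apply: fM; exact: in_setT.
split; first by move=> x y _ _; exact: fM'.
split=> [x [_ xC]|x y _ _|g [Wg gC]].
- split=> [|_ /fsurj[k _ <-]]; first exact: fW.
  by rewrite -!fM' xC.
- by apply: finj; exact: in_setT.
have [k _ kg] := fsurj g Wg; exists k => //; split=> // h _.
by apply: finj; rewrite ?in_setT // !fM' kg gC //; exact: fW.
Qed.

(** Transported by the isomorphism, the coordinates of the center of the Weyl group are integral,
    additive and separating on the center of the presented group. *)
Lemma isog_center_free :
  group_isog (group_center [set: hat]) (group_center W) ->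
  free_abelian (group_center [set: hat]).
Proof.
move=> [f [fM [fZ finj _]]].
have fMz (z w : center hat) :
    f (cval z * cval w)%g = (f (cval z) * f (cval w))%g.
  by apply: fM; apply/mem_set; exact: center_set.
have fC (z : center hat) : group_center W (f (cval z)).
  by apply: fZ; exact: center_set.
pose i0 := Ordinal nu_gt0.
(* An index below nu^2 codes a pair through r nu + s; [i0] is the default for out-of-range
   values. *)
pose row k : 'I_nu := insubd i0 (k %/ nu)%N.
pose col k : 'I_nu := insubd i0 (k %% nu)%N.
pose F k (z : center hat) : int := Num.floor (bf (row k) (col k) (f (cval z))).
have FE k z : (F k z)%:~R = bf (row k) (col k) (f (cval z)).
  apply/eqP; rewrite floorK //.
  exact: (bform_int semS dimV0 sigma_span _ _ (fC z).1).
apply: (@free_center_of_coordinates _ (nu * nu) F) => [k z w|z Fz].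
  apply: (@intr_inj R); rewrite intrB !FE; apply/eqP; rewrite eq_sym subr_eq.
  by rewrite -bf_centerM // -fMz -cvalD subrK.
have f1 : f 1%g = 1%g.
  by apply: (mulIg (f 1%g)); rewrite -(fMz 0 0) !mul1g.
apply: cval_inj; apply: finj; try exact/mem_set/center_set.
rewrite f1; apply: (bform_inj semS Ssigma nu_gt0 dimV0 sigma_span) => // r s _.
have lt_rs : (r * nu + s < nu * nu)%N.
  by apply: (@leq_trans (r * nu + nu)%N); rewrite ?ltn_add2l // -mulSnr
    leq_mul2r ltn_ord orbT.
have := FE (r * nu + s)%N z; rewrite Fz // /row /col divnMDl // modnMDl.
rewrite divn_small // modn_small // addn0.
by rewrite !valKd => <-.
Qed.

End Kernel.

Theorem theorem5p16 (R : realType) (V0 : vectType R) (nu : nat)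
    (S : set V0) (sigma : 'I_nu -> V0) (supp : {set {set 'I_nu}}) :
  (0 < nu)%N -> \dim {:V0} = nu ->
  semilattice S ->
  (forall i, S (sigma i)) -> zbasis (zspan S) sigma ->
  supporting_class S sigma supp ->
  [<-> group_isog [set: weyl_hat S] (weyl_group S);
       group_isog (group_center [set: weyl_hat S]) (group_center (weyl_group S));
       free_abelian (group_center [set: weyl_hat S]);
       is_group_iso [set: weyl_hat S] (weyl_group S) (@psi R V0 S);
       forall eps : collection supp, integral_collection eps <->
         eps =1 @trivial_collection nu supp;
       minimal_generators (weyl_group S) (Pi_reflections S sigma supp)].
Proof.
move=> nu_gt0 dimV0 semS Ssigma sigmaZ suppS; tfae.
- exact: isog_center.
- exact: (isog_center_free semS Ssigma nu_gt0 dimV0 sigmaZ).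
- move=> /(free_psi_injective semS Ssigma nu_gt0 dimV0 sigmaZ suppS).
  exact: psi_injective_iso.
- move=> /iso_psi_injective inj.
  exact: (psi_injective_trivial semS Ssigma nu_gt0 dimV0 sigmaZ suppS inj).
- move=> /(trivial_psi_injective semS Ssigma nu_gt0 dimV0 sigmaZ suppS).
  exact: psi_injective_minimal.
(* The cycle closes through triviality of integral collections, then injectivity of [psi], which is
   itself the isomorphism sought. *)
- move=> /(minimal_trivial semS Ssigma nu_gt0 dimV0 sigmaZ suppS).
  move=> /(trivial_psi_injective semS Ssigma nu_gt0 dimV0 sigmaZ suppS).
  by move=> /(psi_injective_iso semS) iso; exists (@psi R V0 S).
Qed.
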